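(* Let $\Delta=\Delta_1\supset\dots\supset\Delta_k$ be a good chain of root subsystems of $\Delta$ and set $\tau=\sum_{i=1}^k\theta_i^\vee$, where $\theta_i$ is the highest root of $\Delta_i$. Then $\tau\in X^+$. Moreover, if $\alpha\in\Pi$, we have $(\tau,\alpha)\ne0$ if and only if $\alpha\in\Pi_k'$. Conversely, for each $\tau\in X^+$ there exists a good chain $\Delta=\Delta_1\supset\dots\supset\Delta_k$ such that $\tau=\sum_{i=1}^k\theta_i^\vee$.
   Context: $\Delta$ is the (finite, reduced, irreducible, crystallographic) root system of a complex simple Lie algebra, with positive system $\Delta^+$, simple roots $\Pi$ and highest root $\theta$, in the Euclidean space $V$ spanned by $\Delta$, with Weyl group invariant inner product $(\ ,\ )$ (induced by the Killing form). $\alpha^\vee=2\alpha/(\alpha,\alpha)\in V$; $Q^\vee\subset V$ is the coroot lattice. If $\Delta$ is simply laced all roots are regarded as long. $X=\{\tau\in Q^\vee\mid(\tau,\alpha)\ge0\ \forall\alpha\in\Pi,\ (\tau,\theta)\le2\}$ (the coroot lattice points in twice the closed fundamental alcove) and $X^+=X\setminus\{0\}$. A chain $\Delta=\Delta_1\supset\Delta_2\supset\dots\supset\Delta_k$ of standard parabolic irreducible subsystems of $\Delta$, with $\theta_i$ the highest root of $\Delta_i$ ($\Delta_i$ having simple system $\Pi_i=\Delta_i\cap\Pi$), is a good chain if: (1) $\Delta_i$ is an irreducible component of $\{\beta\in\Delta_{i-1}\mid(\beta,\theta_{i-1})=0\}$ for $i\ge2$; (2) if $\beta\in\Pi$ and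 $(\beta,\theta_i)>0$, then $\beta\perp\Delta_j$ for all $j\ge i+2$; (3) each $\Delta_i$ contains at least one long root (of $\Delta$). For a good chain, $\Pi_i'=\{\beta\in\Pi_i\mid(\beta,\theta_i)\ne0\}$. *)

(* Defs.v *)
From HB Require Import structures.
From mathcomp Require Import all_boot all_order all_algebra sesquilinear finmap.
From mathcomp Require Import boolp classical_sets reals.

Set Implicit Arguments.
Unset Strict Implicit.
Unset Printing Implicit Defensive.

Import Order.TTheory GRing.Theory Num.Theory.
Local Open Scope fset_scope.
Local Open Scope ring_scope.

(* The Euclidean space is a finite dimensional real vector space V with an
   inner product ip, that is, a positive definite symmetric bilinear form. *)
Section RootSystems.
Variables (R : realType) (V : vectType R) (ip : {dot V for idfun}).
Implicit Types (D C P : {fset V}) (a b t u v : V).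

Definition coroot a : V := (2 / ip a a) *: a.

Definition reflection a v : V := v - ip v (coroot a) *: a.

(* D is only required to be a root system in the subspace it spans. *)
Definition root_system D : Prop :=
  [/\ 0 \notin D,
      forall a b, a \in D -> b \in D -> reflection a b \in D,
      forall a b, a \in D -> b \in D -> ip b (coroot a) \is a Num.int &
      forall a (c : R), a \in D -> c *: a \in D -> c = 1 \/ c = -1].

Definition irreducible_roots D : Prop :=
  D != fset0 /\
  forall C, C `<=` D -> C != fset0 ->
    (forall a b, a \in C -> b \in D `\` C -> ip a b = 0) -> C = D.

Definition irreducible_component D C : Prop :=
  [/\ C `<=` D, irreducible_roots C &
      forall a b, a \in C -> b \in D `\` C -> ip a b = 0].

Definition nat_span P v : Prop :=
  exists c : V -> nat, v = \sum_(a <- P) a *+ c a.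

(* Choosing P amounts to choosing the positive system of the roots in D that
   lie in nat_span P. *)
Definition simple_roots D P : Prop :=
  [/\ P `<=` D, free P &
      forall b, b \in D -> nat_span P b \/ nat_span P (- b)].

(* The highest root is the greatest root for the order u <= v iff v - u is
   a sum of simple roots. *)
Definition is_highest_root D P t : Prop :=
  t \in D /\ forall b, b \in D -> nat_span P (t - b).

(* The junk value 0 is never taken when D is an irreducible root system with
   simple roots P. *)
Definition highest_root D P : V := xget 0 [set t | is_highest_root D P t]%classic.

Variables (Delta Pi : {fset V}).

Definition coroot_lattice v : Prop :=
  exists c : V -> int, v = \sum_(a <- Delta) coroot a *~ c a.

Definition X v : Prop :=
  [/\ coroot_lattice v,
      forall a, a \in Pi -> 0 <= ip v a &
      ip v (highest_root Delta Pi) <= 2].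

Definition Xplus v : Prop := X v /\ v != 0.

(* The long roots are those of maximal length, so that all roots are long when
   Delta is simply laced. *)
Definition long_root a : Prop :=
  a \in Delta /\ forall b, b \in Delta -> ip b b <= ip a a.

Definition standard_parabolic C : Prop :=
  exists2 P, P `<=` Pi & C = [fset b in Delta | b \in <<P>>%VS].

Definition sub_highest_root C : V := highest_root C (C `&` Pi).

(* The chain Delta_1, ..., Delta_k is the list of its members, which is indexed
   from 0. Each inclusion is part of irreducible_component; it is strict since
   a highest root is not orthogonal to itself. *)
Definition good_chain (ch : seq {fset V}) : Prop :=
  let D i := nth fset0 ch i in
  let theta i := sub_highest_root (D i) in
  [/\ [/\ (0 < size ch)%N, D 0%N = Delta &
          forall i, (i < size ch)%N ->
            standard_parabolic (D i) /\ irreducible_roots (D i)],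
      forall i, (i.+1 < size ch)%N ->
        irreducible_component [fset b in D i | ip b (theta i) == 0] (D i.+1),
      forall i j b, (i.+2 <= j < size ch)%N -> b \in Pi -> 0 < ip b (theta i) ->
        forall g, g \in D j -> ip b g = 0 &
      forall i, (i < size ch)%N -> exists2 a, a \in D i & long_root a].

Definition chain_sum (ch : seq {fset V}) : V :=
  \sum_(C <- ch) coroot (sub_highest_root C).

(* The set Pi_i' of the member C = Delta_i of a chain. *)
Definition nonorthogonal_simple_roots C : {fset V} :=
  [fset b in C `&` Pi | ip b (sub_highest_root C) != 0].

End RootSystems.

(* Main.v *)
Require Import Defs.
From HB Require Import structures.
From mathcomp Require Import all_boot all_order all_algebra sesquilinear finmap.
From mathcomp Require Import boolp classical_sets reals.
From mathcomp Require Import ring lra zify.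

(** The argument is uniform and does not use the classification. Write t_i for
    the highest root of the member Delta_i of a chain, and t_i^ for its coroot.

    From chains to X+. The members of a good chain are nested, Delta_j is
    orthogonal to t_i for i < j, and each t_i is long in Delta. Given a simple
    root a, let m be the last index with a in Delta_m. The pairings (t_j^, a)
    with j < m vanish. If m is the last index of the chain, the sum pairs with a
    as t_m^ does, which is nonnegative since t_m is dominant for Delta_m
    ([chain_sum_last]). Otherwise either a is orthogonal to t_m, hence to
    Delta_{m+1}, or (t_m^, a) = 1 and (t_{m+1}^, a) = -1 because these roots are
    long, while a is orthogonal to the later members by the second condition on
    good chains; in both cases the pairing is 0 ([chain_sum_inner]). This uses
    that a simple root not orthogonal to t_m is attached to every component of
    the orthogonal of t_m ([step_all_attached]).

    From X+ to chains. Two facts carry the proof. First, an element of the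
    coroot lattice whose pairings with all roots are at most 1 is zero
    ([lattice_small_eq0]). Secondly, if tau is at most 2 on all roots and equal
    to 2 on pairwise orthogonal roots t, then reflecting a root b in these t
    bounds (tau, b) - 2 sum (b, t^) by 2 in absolute value
    ([orth_coroot_bound]). Together they show that, as long as tau differs from
    the sum of the t^, some root b orthogonal to all these t satisfies
    (tau, b) = 2 ([next_orth_root]). Since tau vanishes on the simple roots
    outside any parabolic member whose highest root has value 2 ([tau_outer]),
    such a b belongs to the last member of the chain ([tau_step_in]), and the
    chain is extended by the component of b in the orthogonal of the last
    highest root. The bound also yields the two remaining conditions: the new
    member contains a long root ([tau_step_long]), and it is orthogonal to the
    simple roots that are positive on earlier highest roots, except the last one
    ([tau_chain_extend]). *)

Set Implicit Arguments.
Unset Strict Implicit.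
Unset Printing Implicit Defensive.

Import Order.TTheory GRing.Theory Num.Theory.
Local Open Scope fset_scope.
Local Open Scope ring_scope.

(** * Preliminaries on sums, maxima and integers *)

Lemma int_ltD1 (R : realType) (x y : R) :
  x \is a Num.int -> y \is a Num.int -> x < y -> x + 1 <= y.
Proof.
move=> /intrP[m ->] /intrP[n ->].
by rewrite -[1]/(1%:~R) -rmorphD /= ltr_int ler_int lezD1.
Qed.

Lemma seq_argmax (R : realType) (T : eqType) (s : seq T) (p : T -> Prop)
    (f : T -> R) x0 :
  x0 \in s -> p x0 ->
  exists x, [/\ x \in s, p x & forall y, y \in s -> p y -> f y <= f x].
Proof.
elim: s x0 => // z s IH x0 x0s px0.
have [[x xs px]|none] := pselect (exists2 x, x \in s & p x); last first.
  have only y : y \in z :: s -> p y -> y = z.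
    by rewrite inE => /predU1P[//|ys] py; case: none; exists y.
  exists x0; split=> [||y ys py]; [exact: x0s|exact: px0|].
  by rewrite (only y ys py) (only x0 x0s px0).
have [m [ms pm mmax]] := IH x xs px.
have [pz|npz] := pselect (p z); last first.
  exists m; split=> // [|y]; first by rewrite inE ms orbT.
  by rewrite inE => /predU1P[->//|]; apply: mmax.
have [zm|mz] := leP (f z) (f m).
  exists m; split=> // [|y]; first by rewrite inE ms orbT.
  by rewrite inE => /predU1P[->//|]; apply: mmax.
exists z; split=> // [|y]; first by rewrite inE eqxx.
rewrite inE => /predU1P[->//|ys] py.
by apply: le_trans (ltW mz); apply: mmax.
Qed.

Lemma ler_sum_sub (R : realType) (T : choiceType) (s : seq T) (P : {fset T})
    (f : T -> R) :
  uniq s -> {subset s <= P} -> (forall x, x \in P -> 0 <= f x) ->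
  \sum_(x <- s) f x <= \sum_(x <- P) f x.
Proof.
move=> us sP f0.
have sE : \sum_(x <- P | x \in s) f x = \sum_(x <- s) f x.
  rewrite -big_filter; apply: perm_big; apply: uniq_perm => [||x] //.
    by rewrite filter_uniq ?fset_uniq.
  by rewrite mem_filter; case xs: (x \in s) => //=; apply: sP.
rewrite [leRHS](bigID (fun x => x \in s)) /= sE.
by rewrite lerDl big_seq_cond sumr_ge0 // => x /andP[/f0].
Qed.

(** * Inner products and coroots *)

Section InnerProduct.
Variables (R : realType) (V : vectType R) (ip : {dot V for idfun}).
Implicit Types (a b t u v w : V).

Lemma ipC u v : ip u v = ip v u.
Proof. by have := hermC ip u v; rewrite /= expr0 mul1r. Qed.

Lemma ipDl u v w : ip (u + v) w = ip u w + ip v w.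
Proof. exact: linearDl. Qed.

Lemma ipBl u v w : ip (u - v) w = ip u w - ip v w.
Proof. exact: linearBl. Qed.

Lemma ipBr u v w : ip w (u - v) = ip w u - ip w v.
Proof. exact: linearBr. Qed.

Lemma ipNl u w : ip (- u) w = - ip u w.
Proof. exact: linearNl. Qed.

Lemma ipNr u w : ip w (- u) = - ip w u.
Proof. exact: linearNr. Qed.

Lemma ip0l w : ip 0 w = 0.
Proof. exact: linear0l. Qed.

Lemma ipZl k u w : ip (k *: u) w = k * ip u w.
Proof. exact: linearZl_LR. Qed.

Lemma ipZr k u w : ip w (k *: u) = k * ip w u.
Proof. by rewrite ipC ipZl ipC. Qed.

Lemma ipMz u v z : ip u (v *~ z) = z%:~R * ip u v.
Proof. by rewrite -scaler_int ipZr. Qed.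

Lemma ip_suml I (r : seq I) P (F : I -> V) w :
  ip (\sum_(i <- r | P i) F i) w = \sum_(i <- r | P i) ip (F i) w.
Proof. exact: linear_sumlz. Qed.

Lemma ip_sumr I (r : seq I) P (F : I -> V) w :
  ip w (\sum_(i <- r | P i) F i) = \sum_(i <- r | P i) ip w (F i).
Proof. by rewrite ipC ip_suml; apply: eq_bigr => i _; rewrite ipC. Qed.

Lemma ip_gt0 v : v != 0 -> 0 < ip v v.
Proof. exact: neq0_dnorm_gt0. Qed.

Lemma ip_ge0 v : 0 <= ip v v.
Proof. by have [->|/ip_gt0/ltW//] := eqVneq v 0; rewrite ip0l. Qed.

Lemma ip_eq0 v : ip v v = 0 -> v = 0.
Proof. by move=> v0; apply: contra_eq v0 => /ip_gt0 /lt0r_neq0. Qed.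

(** The hypothesis says that u - v has nonpositive square norm. This bounds the
    Cartan integers without any use of the Cauchy-Schwarz inequality. *)
Lemma ip_dist_le0 u v : ip u u + ip v v <= 2 * ip u v -> u = v.
Proof.
move=> le_uv; apply/eqP; rewrite -subr_eq0; apply/eqP/ip_eq0.
apply: le_anti; rewrite ip_ge0 andbT !ipBl !ipBr (ipC v u); lra.
Qed.

Lemma span_orth (s : seq V) v w :
  (forall a, a \in s -> ip a w = 0) -> v \in <<s>>%VS -> ip v w = 0.
Proof.
move=> sw; rewrite -[s]/(val (in_tuple s)) => /coord_span ->.
rewrite ip_suml big1 // => i _.
by rewrite ipZl sw ?mulr0 // mem_nth.
Qed.

Lemma ip_coroot v a : ip v (coroot ip a) = 2 * ip v a / ip a a.
Proof. by rewrite ipZr; ring. Qed.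

Lemma ip_corootl v a : ip (coroot ip a) v = 2 * ip v a / ip a a.
Proof. by rewrite ipC ip_coroot. Qed.

Lemma ip_coroot_mul v a : a != 0 -> ip v (coroot ip a) * ip a a = 2 * ip v a.
Proof. by move=> /ip_gt0/lt0r_neq0 a0; rewrite ip_coroot divfK. Qed.

Lemma coroot_self a : a != 0 -> ip a (coroot ip a) = 2.
Proof. by move=> /ip_gt0/lt0r_neq0 a0; rewrite ip_coroot mulfK. Qed.

Lemma coroot_gt0 v a : a != 0 -> (0 < ip v (coroot ip a)) = (0 < ip v a).
Proof. by move=> /ip_gt0 a0; rewrite ip_coroot pmulr_lgt0 ?invr_gt0// pmulr_rgt0. Qed.

Lemma coroot_lt0 v a : a != 0 -> (ip v (coroot ip a) < 0) = (ip v a < 0).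
Proof. by move=> /ip_gt0 a0; rewrite ip_coroot pmulr_llt0 ?invr_gt0// pmulr_rlt0. Qed.

Lemma coroot_eq0 v a : a != 0 -> (ip v (coroot ip a) == 0) = (ip v a == 0).
Proof.
move=> /ip_gt0/lt0r_neq0 a0.
by rewrite ip_coroot !mulf_eq0 invr_eq0 (negPf a0) orbF pnatr_eq0.
Qed.

Lemma ip_reflection a u v : a != 0 ->
  ip (reflection ip a u) (reflection ip a v) = ip u v.
Proof.
move=> a0; have := ip_coroot_mul u a0; have := ip_coroot_mul v a0.
rewrite /reflection; move: (ip u (coroot ip a)) (ip v (coroot ip a)) => x y hy hx.
rewrite !ipBl !ipBr !ipZl !ipZr (ipC a v).
have k1 : y * (x * ip a a) = 2 * (y * ip u a) by rewrite hx mulrCA.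
have k2 : y * (x * ip a a) = 2 * (x * ip v a) by rewrite mulrCA hy mulrCA.
by lra.
Qed.

End InnerProduct.

(** * Coordinates on a free family *)

Section Coordinates.
Variables (R : realType) (V : vectType R).
Implicit Types (P Q : {fset V}) (a b u v : V).

(** The coordinate of v on the element a of P, when P is free and v lies in the
    span of P; it is linear in v in all cases. The sum has the single term where
    the enumeration of P reaches a. *)
Definition cf P a v : R :=
  \sum_(i < size P | tnth (in_tuple P) i == a) coord (in_tuple P) i v.

Lemma cfD P a u v : cf P a (u + v) = cf P a u + cf P a v.
Proof. by rewrite /cf -big_split; apply: eq_bigr => i _; rewrite linearD. Qed.

Lemma cfZ P a k v : cf P a (k *: v) = k * cf P a v.
Proof. by rewrite /cf mulr_sumr; apply: eq_bigr => i _; rewrite linearZ. Qed.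

Lemma cfN P a v : cf P a (- v) = - cf P a v.
Proof. by rewrite -scaleN1r cfZ mulN1r. Qed.

Lemma cfB P a u v : cf P a (u - v) = cf P a u - cf P a v.
Proof. by rewrite cfD cfN. Qed.

Lemma cf0 P a : cf P a 0 = 0.
Proof. by rewrite -(scale0r 0) cfZ mul0r. Qed.

Lemma cf_sum P a (I : eqType) (r : seq I) (F : I -> V) :
  cf P a (\sum_(i <- r) F i) = \sum_(i <- r) cf P a (F i).
Proof.
elim: r => [|i r IH]; first by rewrite !big_nil cf0.
by rewrite !big_cons cfD IH.
Qed.

Lemma cf_mem P a b : free P -> a \in P -> b \in P -> cf P a b = (a == b)%:R.
Proof.
move=> fP aP bP; have uP := free_uniq fP.
have ltb : (index b P < size P)%N by rewrite index_mem.
have eb : b = tnth (in_tuple P) (Ordinal ltb).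
  by rewrite (tnth_nth 0) /= nth_index.
rewrite /cf; under eq_bigr => i _ do
  rewrite [X in coord _ _ X]eb (tnth_nth 0) coord_free //.
have [->|ne] := eqVneq a b.
  rewrite (bigD1 (Ordinal ltb)) /=; last by rewrite -eb.
  rewrite eqxx big1 ?addr0 // => i /andP[_ ni].
  by case: eqP => // ee; move: ni; rewrite ee eqxx.
rewrite big1 // => i /eqP ti.
case: eqP => //= /(congr1 val) /= ii; case/eqP: ne; rewrite -ti (tnth_nth 0) /=.
by rewrite -ii nth_index.
Qed.

Lemma cf_sumP P a (c : V -> R) : free P -> a \in P ->
  cf P a (\sum_(b <- P) c b *: b) = c a.
Proof.
move=> fP aP; rewrite cf_sum (bigD1_seq a) ?free_uniq //= cfZ cf_mem // eqxx mulr1.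
rewrite big_seq_cond big1 ?addr0 // => b /andP[bP /negPf ba].
by rewrite cfZ cf_mem // eq_sym ba mulr0.
Qed.

Lemma cf_span P v : free P -> v \in <<P>>%VS -> v = \sum_(a <- P) cf P a v *: a.
Proof.
move=> fP; rewrite -{1}[P : seq V]/(val (in_tuple P)) => /coord_span {1}->.
rewrite [RHS](big_nth 0) big_mkord; apply: eq_bigr => i _; congr (_ *: _).
rewrite /cf (bigD1 i) ?(tnth_nth 0)//= big1 ?addr0 // => j /andP[].
rewrite (tnth_nth 0) /= nth_uniq ?free_uniq //.
by rewrite val_eqE => ->.
Qed.

Lemma free_fsubset P Q : Q `<=` P -> free P -> free Q.
Proof.
move=> QP fP; have pQ : perm_eq Q [seq x <- P | x \in Q].
  apply: uniq_perm; rewrite ?filter_uniq ?fset_uniq// => x.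
  by rewrite mem_filter; case xQ: (x \in Q) => //=; rewrite (fsubsetP QP).
by rewrite (perm_free pQ) filter_free.
Qed.

Lemma cf_out P Q a v : free P -> Q `<=` P -> a \in P -> a \notin Q ->
  v \in <<Q>>%VS -> cf P a v = 0.
Proof.
move=> fP QP aP aQ vQ; rewrite (cf_span (free_fsubset QP fP) vQ) cf_sum.
rewrite big_seq_cond big1 // => b /andP[bQ _].
rewrite cfZ (cf_mem fP aP (fsubsetP QP b bQ)).
by have -> : (a == b) = false; [apply: contraNF aQ => /eqP -> | rewrite mulr0].
Qed.

Lemma nat_span_cf P v a : free P -> a \in P -> nat_span P v -> cf P a v \is a Num.nat.
Proof.
move=> fP aP [c ->]; under eq_bigr => b _ do rewrite -scaler_nat.
by rewrite (cf_sumP (fun b => (c b)%:R)).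
Qed.

Lemma nat_span_span P v : nat_span P v -> v \in <<P>>%VS.
Proof.
case=> c ->; rewrite big_seq_cond; apply: rpred_sum => b /andP[bP _].
by rewrite rpredMn // memv_span.
Qed.

Lemma nat_spanP P v : free P -> v \in <<P>>%VS ->
  (forall a, a \in P -> cf P a v \is a Num.nat) -> nat_span P v.
Proof.
move=> fP vP vn; exists (fun a => Num.truncn (cf P a v)).
rewrite {1}(cf_span fP vP) big_seq_cond [RHS]big_seq_cond.
apply: eq_bigr => a /andP[aP _].
by rewrite -scaler_nat truncnK ?vn.
Qed.

Lemma nat_spanD P u v : nat_span P u -> nat_span P v -> nat_span P (u + v).
Proof.
case=> c -> [d ->]; exists (fun a => (c a + d a)%N).
by rewrite -big_split; apply: eq_bigr => a _; rewrite mulrnDr.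
Qed.

Lemma nat_span_mem P a : a \in P -> nat_span P a.
Proof.
move=> aP; exists (fun b => (b == a)%N).
rewrite (bigD1_seq a) ?fset_uniq //= eqxx mulr1n big1 ?addr0// => b /negPf ->.
by rewrite mulr0n.
Qed.

Lemma nat_spanMn P v n : nat_span P v -> nat_span P (v *+ n).
Proof.
case=> c ->; exists (fun a => (c a * n)%N); rewrite -sumrMnl.
by apply: eq_bigr => a _; rewrite mulrnA.
Qed.

Lemma nat_span0 P : nat_span P 0.
Proof. by exists (fun=> 0%N); rewrite big1. Qed.

Lemma cf_inj P u v : free P -> u \in <<P>>%VS -> v \in <<P>>%VS ->
  (forall a, a \in P -> cf P a u = cf P a v) -> u = v.
Proof.
move=> fP uP vP uv; rewrite (cf_span fP uP) (cf_span fP vP) big_seq [RHS]big_seq.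
by apply: eq_bigr => a aP; rewrite uv.
Qed.

End Coordinates.

(** * Root systems with a base, and the highest root *)

Section RootBase.
Variables (R : realType) (V : vectType R) (ip : {dot V for idfun}).
Variables (D P : {fset V}).
Hypotheses (HD : root_system ip D) (HP : simple_roots D P).
Implicit Types (a b c t u v w : V) (S T : {fset V}).

Lemma root_neq0 a : a \in D -> a != 0.
Proof. by case: HD => D0 _ _ _ aD; apply: contraNneq D0 => <-. Qed.

Lemma root_reflection a b : a \in D -> b \in D -> b - ip b (coroot ip a) *: a \in D.
Proof. by case: HD => _ + _ _; apply. Qed.

Lemma root_int a b : a \in D -> b \in D -> ip b (coroot ip a) \is a Num.int.
Proof. by case: HD => _ _ + _; apply. Qed.

Lemma root_opp a : a \in D -> - a \in D.
Proof.
move=> aD; have := root_reflection aD aD.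
by rewrite coroot_self ?root_neq0 // scaler_nat mulr2n opprD addNKr.
Qed.

Lemma simple_root a : a \in P -> a \in D.
Proof. by case: HP => /fsubsetP + _ _; apply. Qed.

Lemma simple_free : free P.
Proof. by case: HP. Qed.
Let fP := simple_free.

Lemma root_sign b : b \in D -> nat_span P b \/ nat_span P (- b).
Proof. by case: HP => _ _; apply. Qed.

Lemma root_span b : b \in D -> b \in <<P>>%VS.
Proof. by move=> /root_sign[/nat_span_span //|/nat_span_span]; rewrite memvN. Qed.

Lemma coroot_ge1 a b : a \in D -> b \in D -> 0 < ip b a -> 1 <= ip b (coroot ip a).
Proof.
move=> aD bD; rewrite -(coroot_gt0 ip b (root_neq0 aD)) => h.
by rewrite -[1]add0r int_ltD1 ?root_int ?rpred0.
Qed.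

Lemma coroot_leN1 a b : a \in D -> b \in D -> ip b a < 0 -> ip b (coroot ip a) <= -1.
Proof.
move=> aD bD ba; rewrite lerNr -ipNl; apply: coroot_ge1 => //; first exact: root_opp.
by rewrite ipNl oppr_gt0.
Qed.

(** A Cartan integer against a different root, at least as long, is at most 1. *)
Lemma coroot_le1 a b : a \in D -> b \in D -> ip b b <= ip a a -> b != a ->
  ip b (coroot ip a) <= 1.
Proof.
move=> aD bD ba; apply: contraNT; rewrite -ltNge => h.
have h2 : 2 <= ip b (coroot ip a) by rewrite -[2]/(1 + 1) int_ltD1 ?root_int ?rpred1.
apply/eqP/(ip_dist_le0 (ip := ip)).
have a0 := ip_gt0 ip (root_neq0 aD); rewrite -(ip_coroot_mul ip b (root_neq0 aD)).
by have := ler_wpM2r (ltW a0) h2; lra.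
Qed.

(** The Cartan integer of a and b against the longer of the two is 1, so that a
    reflection gives the difference up to sign. *)
Lemma root_sub a b : a \in D -> b \in D -> 0 < ip a b -> a != b -> a - b \in D.
Proof.
wlog ab : a b / ip a a <= ip b b => [H aD bD ab0 nab|aD bD ab0 nab].
  have [/H|/ltW/H] := leP (ip a a) (ip b b); first exact.
  by rewrite -[a - b]opprB => h; apply: root_opp; apply: h; rewrite // 1?ipC 1?eq_sym.
have := root_reflection bD aD.
suff -> : ip a (coroot ip b) = 1 by rewrite scale1r.
by apply: le_anti; rewrite coroot_le1 ?coroot_ge1.
Qed.

(** The height of v relative to the base P: the sum of its coordinates. *)
Definition height v : R := \sum_(a <- P) cf P a v.

Lemma heightD u v : height (u + v) = height u + height v.
Proof. by rewrite /height -big_split; apply: eq_bigr => a _; rewrite cfD. Qed.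

Lemma heightZ k v : height (k *: v) = k * height v.
Proof. by rewrite /height mulr_sumr; apply: eq_bigr => a _; rewrite cfZ. Qed.

Lemma heightN v : height (- v) = - height v.
Proof. by rewrite -scaleN1r heightZ mulN1r. Qed.

Lemma height_simple a : a \in P -> height a = 1.
Proof.
move=> aP; rewrite /height (bigD1_seq a) ?fset_uniq //= cf_mem // eqxx.
rewrite big_seq_cond big1 ?addr0 // => b /andP[bP /negPf ba].
by rewrite cf_mem // ba.
Qed.

Lemma nat_span_cf_ge0 v a : a \in P -> nat_span P v -> 0 <= cf P a v.
Proof. by move=> aP vP; apply: natr_ge0; exact: nat_span_cf. Qed.

Lemma height_ge0 v : nat_span P v -> 0 <= height v.
Proof.
move=> vP; rewrite /height big_seq_cond sumr_ge0 // => a /andP[aP _].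
exact: nat_span_cf_ge0.
Qed.

Lemma height_gt0 v : nat_span P v -> v != 0 -> 0 < height v.
Proof.
move=> vP v0; rewrite lt0r height_ge0 // andbT; apply: contra v0 => /eqP.
rewrite /height big_seq => /eqP; rewrite psumr_eq0 => [/allP h|a aP]; last first.
  exact: nat_span_cf_ge0.
apply/eqP/(cf_inj fP); rewrite ?mem0v ?nat_span_span // => a aP.
by rewrite cf0; apply/eqP; have := h a aP; rewrite aP.
Qed.

Lemma nat_span_ip_ge0 v w : nat_span P v ->
  (forall a, a \in P -> 0 <= ip w a) -> 0 <= ip w v.
Proof.
case=> c -> wP; rewrite ip_sumr big_seq_cond sumr_ge0 // => a /andP[aP _].
by rewrite linearMnr /= mulrn_wge0 // wP.
Qed.

(** A nonzero nonnegative combination of simple roots pairs positively with one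
    of the simple roots occurring in it. *)
Lemma nat_span_pos_pair v : nat_span P v -> v != 0 ->
  exists a, [/\ a \in P, 0 < cf P a v & 0 < ip v a].
Proof.
move=> vP v0; apply: contrapT => none.
have := ip_gt0 ip v0; rewrite {2}(cf_span fP (nat_span_span vP)) ip_sumr big_seq_cond.
apply/negP; rewrite -leNgt; apply: sumr_le0 => a /andP[aP _]; rewrite ipZr.
have := nat_span_cf_ge0 aP vP; rewrite le0r => /predU1P[->|ge0]; first by rewrite mul0r.
rewrite pmulr_rle0 // leNgt; apply/negP => gt0; apply: none.
by exists a.
Qed.

Lemma simple_le0 a b : a \in P -> b \in P -> a != b -> ip a b <= 0.
Proof.
move=> aP bP nab; rewrite leNgt; apply/negP => ab.
have nba : (b == a) = false by rewrite eq_sym; apply: negPf.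
have := root_sub (simple_root aP) (simple_root bP) ab nab.
move=> /root_sign[/(nat_span_cf_ge0 bP)|/(nat_span_cf_ge0 aP)].
  by rewrite cfB (cf_mem fP bP aP) (cf_mem fP bP bP) nba eqxx /=; lra.
by rewrite cfN cfB (cf_mem fP aP aP) (cf_mem fP aP bP) (negPf nab) eqxx /=; lra.
Qed.

Lemma span_orth2 S T v w : (forall a b, a \in S -> b \in T -> ip a b = 0) ->
  v \in <<S>>%VS -> w \in <<T>>%VS -> ip v w = 0.
Proof.
move=> ST vS wT; apply: span_orth vS => a aS; rewrite ipC; apply: span_orth wT.
by move=> b bT; rewrite ipC; apply: ST.
Qed.

(** The support of a root is connected: if the simple roots split into two
    orthogonal parts, every root lies in the span of one of them. *)
Lemma root_split S g : S `<=` P ->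
  (forall a b, a \in S -> b \in P `\` S -> ip a b = 0) -> g \in D ->
  g \in <<S>>%VS \/ g \in <<P `\` S>>%VS.
Proof.
move=> SP orth.
have DSP : P `\` S `<=` P by apply: fsubsetDl.
(* If a + d is a root with a simple and d in the span of the other part, its
   reflection in a is d - a, which has coordinates of both signs. *)
have mixed A B a d : A `<=` P -> B `<=` P ->
    (forall x y, x \in A -> y \in B -> ip x y = 0) ->
    a \in A -> nat_span P d -> d \in <<B>>%VS -> d != 0 -> a + d \in D -> False.
  move=> AP BP AB aA dP dB d0 adD.
  have aP := fsubsetP AP a aA; have aD := simple_root aP.
  have ad0 : ip d a = 0.
    by apply: span_orth dB => y yB; rewrite ipC AB.
  have aB : a \notin B.
    by apply/negP => /(AB a a aA) /ip_eq0 a0; have := root_neq0 aD; rewrite a0 eqxx.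
  have := root_reflection aD adD.
  have -> : ip (a + d) (coroot ip a) = 2.
    by rewrite ipDl coroot_self ?root_neq0 // ip_coroot ad0 mulr0 mul0r addr0.
  have -> : a + d - 2 *: a = d - a.
    by rewrite scaler_nat mulr2n opprD addrACA subrr add0r.
  move=> /root_sign[/(nat_span_cf_ge0 aP)|neg].
    by rewrite cfB (cf_out fP BP aP aB dB) cf_mem // eqxx /=; lra.
  case/eqP: d0; apply: (cf_inj fP); rewrite ?mem0v ?nat_span_span // => b bP.
  rewrite cf0; have [bB|bB] := boolP (b \in B); last exact: cf_out bB dB.
  have ba : (b == a) = false by apply: contraNF aB => /eqP <-.
  have := nat_span_cf_ge0 bP neg; have := nat_span_cf_ge0 bP dP.
  by rewrite cfN cfB (cf_mem fP bP aP) ba /=; lra.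
(* Positive roots, by induction on the height: subtract a simple root. *)
suff pos n : forall g, nat_span P g -> height g <= n%:R -> g \in D ->
    g \in <<S>>%VS \/ g \in <<P `\` S>>%VS.
  move=> gD; have [gP|gP] := root_sign gD.
    apply: (pos (Num.truncn (height g)).+1) => //.
    by apply/ltW/truncnS_gt.
  have := pos (Num.truncn (height (- g))).+1 (- g) gP _ (root_opp gD).
  rewrite !memvN; apply.
  by apply/ltW/truncnS_gt.
elim: n => {g} [|n IH] g gP gn gD.
  by have := height_gt0 gP (root_neq0 gD); rewrite ltNge gn.
have [a [aP ga0 ipga]] := nat_span_pos_pair gP (root_neq0 gD).
have part : a \in S \/ a \in P `\` S.
  by rewrite inE aP andbT; case: (a \in S); [left|right].
have [->|nga] := eqVneq g a; first by case: part => h; [left|right]; apply: memv_span.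
have dD := root_sub gD (simple_root aP) ipga nga.
have gE : g = a + (g - a) by rewrite addrC subrK.
have [dP|dP] := root_sign dD; last first.
  (* If g and a - g are both nonnegative combinations, g is a multiple of a. *)
  have gk : g = cf P a g *: a.
    apply: (cf_inj fP) => [||b bP]; [exact: root_span | by rewrite memvZ ?memv_span |].
    rewrite cfZ (cf_mem fP bP aP); have [->|ba] := eqVneq b a; first by rewrite mulr1.
    have := nat_span_cf_ge0 bP gP; have := nat_span_cf_ge0 bP dP.
    by rewrite cfN cfB (cf_mem fP bP aP) (negPf ba) /= mulr0; lra.
  by rewrite gk; case: part => h; [left|right]; rewrite memvZ ?memv_span.
have hd : height (g - a) <= n%:R.
  by have := gn; rewrite {1}gE heightD height_simple // -natr1; lra.
have orth' x y : x \in P `\` S -> y \in S -> ip x y = 0.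
  by move=> xT yS; rewrite ipC; apply: orth.
have d0 := root_neq0 dD; have adD : a + (g - a) \in D by rewrite -gE.
case: (IH _ dP hd dD) part => [dS|dT] [aS|aT].
- left; rewrite gE; apply: memvD => //; exact: memv_span.
- by case: (mixed _ _ _ _ DSP SP orth' aT dP dS d0 adD).
- by case: (mixed _ _ _ _ SP DSP orth aS dP dT d0 adD).
- right; rewrite gE; apply: memvD => //; exact: memv_span.
Qed.

(** Raising a root by reflecting it in the simple roots on which it is negative
    ends with a dominant root of the same length. *)
Lemma dominant_above b : b \in D -> exists c, [/\ c \in D, nat_span P (c - b),
  ip c c = ip b b & forall a, a \in P -> 0 <= ip c a].
Proof.
move=> bD; have b0 : nat_span P (b - b) /\ ip b b = ip b b.
  by rewrite subrr; split=> //; apply: nat_span0.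
have [c [cD [cb clen] cmax]] := seq_argmax
  (p := fun c => nat_span P (c - b) /\ ip c c = ip b b) height bD b0.
exists c; split=> // a aP; rewrite leNgt; apply/negP => ca.
have aD := simple_root aP; have a0 := root_neq0 aD.
have rD := root_reflection aD cD.
have [n nE] : exists n : nat, - ip c (coroot ip a) = n%:R.
  apply/natrP; rewrite natrEint rpredN root_int //= oppr_ge0.
  by apply: ltW; rewrite coroot_lt0.
have rE : c - ip c (coroot ip a) *: a = c + a *+ n by rewrite -scaleNr nE scaler_nat.
have := cmax _ rD; rewrite rE.
have -> : ip (c + a *+ n) (c + a *+ n) = ip c c by rewrite -rE ip_reflection.
have cnb : nat_span P (c + a *+ n - b).
  by rewrite addrAC; apply: nat_spanD => //; apply/nat_spanMn/nat_span_mem.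
move=> /(_ (conj cnb clen)).
rewrite -scaler_nat heightD heightZ (height_simple aP) mulr1.
have : ip c (coroot ip a) < 0 by rewrite coroot_lt0.
by rewrite -nE; lra.
Qed.

Lemma dominant_nat_span c : c \in D ->
  (forall a, a \in P -> 0 <= ip c a) -> nat_span P c.
Proof.
move=> cD dom; have [//|neg] := root_sign cD.
have nc0 : - c != 0 by rewrite oppr_eq0 root_neq0.
have [a [aP _]] := nat_span_pos_pair neg nc0.
by rewrite ipNl oppr_gt0 ltNge dom.
Qed.

(** The Dynkin diagram of an irreducible root system is connected. *)
Lemma irr_split S : irreducible_roots ip D -> S `<=` P -> S != fset0 ->
  (forall a b, a \in S -> b \in P `\` S -> ip a b = 0) -> S = P.
Proof.
move=> [_ irr] SP /fset0Pn[a aS] orth.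
have CD : [fset b in D | b \in <<S>>%VS] `<=` D by apply: fset_sub.
have C0 : [fset b in D | b \in <<S>>%VS] != fset0.
  by apply/fset0Pn; exists a; rewrite !inE /= memv_span // simple_root // (fsubsetP SP).
have E := irr _ CD C0.
apply/eqP; rewrite eqEfsubset SP; apply/fsubsetP => b bP.
have : b \in [fset b in D | b \in <<S>>%VS].
  rewrite E ?simple_root // => x y; rewrite !inE /= => /andP[xD xS] /andP[ny yD].
  have [yS|yT] := root_split SP orth yD; first by rewrite yD yS in ny.
  exact: span_orth2 orth xS yT.
rewrite !inE /= => /andP[_ bS]; apply/negPn/negP => nbS.
have := cf_out fP SP bP nbS bS.
by rewrite cf_mem // eqxx /=; lra.
Qed.

(** A root t of maximal height is dominant and has positive coordinates. Every
    root lies below a dominant root c, and (t, c) > 0 makes t - c a root or 0,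
    so that t and c are comparable and c lies below t. *)
Lemma exists_highest : irreducible_roots ip D -> exists t, is_highest_root D P t.
Proof.
move=> irr; have [/fset0Pn[x0 x0D] _] := irr.
have [t [tD _ tmax]] := seq_argmax (p := fun=> True) height x0D I.
have noup c : c \in D -> nat_span P (c - t) -> c = t.
  move=> cD ct; apply/eqP; rewrite -subr_eq0; apply/negPn/negP => /(height_gt0 ct).
  by have := tmax c cD I; rewrite heightD heightN; lra.
have tdom a : a \in P -> 0 <= ip t a.
  by have [c [cD /(noup c cD) <- _ dom]] := dominant_above tD; apply: dom.
have tP := dominant_nat_span tD tdom.
have full x : x \in P -> 0 < cf P x t.
  suff E : [fset a in P | cf P a t != 0] = P.
    by rewrite -{1}E !inE /= => /andP[xP xn0]; rewrite lt0r xn0 nat_span_cf_ge0.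
  apply: irr_split => //; first exact: fset_sub.
    have [a [aP a0 _]] := nat_span_pos_pair tP (root_neq0 tD).
    by apply/fset0Pn; exists a; rewrite !inE /= aP lt0r_neq0.
  move=> a b; rewrite !inE /= => /andP[aP a0] /andP[+ bP]; rewrite bP negbK => /eqP b0.
  have term y : y \in P -> cf P y t * ip y b <= 0.
    move=> yP; have [->|yb] := eqVneq y b; first by rewrite b0 mul0r.
    by rewrite mulr_ge0_le0 ?simple_le0 ?nat_span_cf_ge0.
  have := tdom b bP; rewrite (cf_span fP (nat_span_span tP)) ip_suml.
  rewrite (bigD1_seq a) ?fset_uniq //= ipZl.
  set r := (X in _ + X) => h; have : r <= 0.
    rewrite /r big_seq_cond; apply: sumr_le0 => y /andP[yP _].
    by rewrite ipZl term.
  move=> r0; have := term a aP => ta.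
  have : cf P a t * ip a b = 0 by lra.
  by move/eqP; rewrite mulf_eq0 (negPf a0) => /eqP.
exists t; split=> // b bD.
have [c [cD cb _ cdom]] := dominant_above bD.
have c0 := root_neq0 cD; have cP := dominant_nat_span cD cdom.
have tc : 0 < ip t c.
  have [a [aP _ ca]] := nat_span_pos_pair cP c0.
  rewrite (cf_span fP (nat_span_span tP)) ip_suml (bigD1_seq a) ?fset_uniq //=.
  rewrite ltr_pwDl ?ipZl 1?ipC ?mulr_gt0 ?full // big_seq_cond.
  rewrite sumr_ge0 // => x /andP[xP _].
  by rewrite ipZl ipC mulr_ge0 ?cdom ?nat_span_cf_ge0.
suff tcP : nat_span P (t - c) by rewrite -[t](subrK c) -addrA; apply: nat_spanD.
have [->|ntc] := eqVneq t c; first by rewrite subrr; apply: nat_span0.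
have [//|] := root_sign (root_sub tD cD tc ntc).
by rewrite opprB => /(noup c cD) ct; rewrite ct eqxx in ntc.
Qed.

Lemma highest_rootP : irreducible_roots ip D -> is_highest_root D P (highest_root D P).
Proof.
by move=> irr; have [t tH] := exists_highest irr; apply: (xgetPex 0); exists t.
Qed.

Section HighestRoot.
Variable t : V.
Hypothesis tH : is_highest_root D P t.

(** A vector dominant for P is largest, as a functional on D, at the highest
    root. *)
Lemma highest_ge v b : b \in D ->
  (forall a, a \in P -> 0 <= ip v a) -> ip v b <= ip v t.
Proof.
move=> bD vdom; rewrite -subr_ge0 -ipBr; apply: nat_span_ip_ge0 => //.
by case: tH => _; apply.
Qed.

Lemma highest_dominant a : a \in P -> 0 <= ip t a.
Proof.
case: tH => tD tge aP; rewrite leNgt; apply/negP => ta.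
have aD := simple_root aP; have a0 := root_neq0 aD.
have := tge _ (root_reflection aD tD); rewrite opprB addrCA subrr addr0.
move=> /(nat_span_cf_ge0 aP); rewrite cfZ cf_mem // eqxx mulr1.
by rewrite leNgt coroot_lt0 // ta.
Qed.

Lemma highest_cf_ge1 a : a \in P -> 1 <= cf P a t.
Proof.
move=> aP; case: tH => tD /(_ a (simple_root aP)) /(nat_span_cf_ge0 aP).
by rewrite cfB (cf_mem fP aP aP) eqxx /=; lra.
Qed.

Lemma highest_longest b : b \in D -> ip b b <= ip t t.
Proof.
move=> bD; have [c [cD _ <- cdom]] := dominant_above bD.
have := highest_ge cD cdom; have := highest_ge cD highest_dominant.
by move=> h1 h2; rewrite (le_trans h2) // ipC.
Qed.

End HighestRoot.

End RootBase.

(** * Standard parabolic subsystems *)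

Section Parabolic.
Variables (R : realType) (V : vectType R) (ip : {dot V for idfun}).
Variables (D P Q : {fset V}).
Hypotheses (HD : root_system ip D) (HP : simple_roots D P) (QP : Q `<=` P).

Let DQ := [fset b in D | b \in <<Q>>%VS].

Lemma parabolic_root_system : root_system ip DQ.
Proof.
have [D0 Dr Di Dred] := HD; split.
- by rewrite !inE (negPf D0).
- move=> a b; rewrite !inE /= => /andP[aD aQ] /andP[bD bQ].
  by rewrite Dr // memvB // memvZ.
- by move=> a b; rewrite !inE /= => /andP[aD _] /andP[bD _]; apply: Di.
- by move=> a c; rewrite !inE /= => /andP[aD _] /andP[bD _]; apply: (Dred a).
Qed.

Lemma parabolic_simple : DQ `&` P = Q.
Proof.
have [_ fP _] := HP.
apply/fsetP => a; rewrite !inE /=; apply/idP/idP => [/andP[/andP[_ aQ] aP]|aQ].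
  apply/negPn/negP => naQ; have := cf_out fP QP aP naQ aQ.
  by rewrite cf_mem // eqxx /=; lra.
by rewrite (simple_root HP) ?(fsubsetP QP) // memv_span.
Qed.

Lemma parabolic_simple_roots : simple_roots DQ Q.
Proof.
have [PD fP sgn] := HP; have fQ := free_fsubset QP fP.
have sub v : v \in <<Q>>%VS -> nat_span P v -> nat_span Q v.
  move=> vQ vP; apply: nat_spanP => // a aQ; have aP := fsubsetP QP a aQ.
  suff <- : cf P a v = cf Q a v by apply: nat_span_cf.
  rewrite {1}(cf_span fQ vQ) cf_sum (bigD1_seq a) ?fset_uniq //=.
  rewrite cfZ (cf_mem fP aP aP) eqxx mulr1.
  rewrite big_seq_cond big1 ?addr0 // => b /andP[bQ /negPf ba].
  by rewrite cfZ (cf_mem fP aP (fsubsetP QP b bQ)) eq_sym ba mulr0.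
split=> //.
  by rewrite -parabolic_simple; apply: fsubsetIl.
move=> b; rewrite !inE /= => /andP[bD bQ].
by have [h|h] := sgn b bD; [left|right]; apply: sub; rewrite ?memvN.
Qed.

End Parabolic.

(** * Irreducible components *)

Section Components.
Variables (R : realType) (V : vectType R) (ip : {dot V for idfun}).
Implicit Types (D P C : {fset V}) (a b : V).

(** A smallest subset containing b and orthogonal to the rest of D is
    irreducible. *)
Lemma exists_component D b : b \in D ->
  exists2 C, irreducible_component ip D C & b \in C.
Proof.
move=> bD.
suff main n C : (#|` C| <= n)%N -> b \in C -> C `<=` D ->
    (forall x y, x \in C -> y \in D `\` C -> ip x y = 0) ->
    exists2 C', irreducible_component ip D C' & b \in C'.
  by apply: (main _ D (leqnn _)) => // x y _; rewrite !inE andNb.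
elim: n C => [|n IH] C.
  by rewrite leqn0 cardfs_eq0 => /eqP -> ; rewrite inE.
move=> Cn bC CD Corth.
have [irr|nirr] := pselect (irreducible_roots ip C); first by exists C.
have [C' [C'C C'0 C'orth C'ne]] : exists C', [/\ C' `<=` C, C' != fset0,
    forall x y, x \in C' -> y \in C `\` C' -> ip x y = 0 & C' != C].
  apply: contrapT => none; apply: nirr; split; first by apply/fset0Pn; exists b.
  move=> C' C'C C'0 orth; apply: contrapT => ne; apply: none.
  by exists C'; split=> //; apply/eqP.
have lt_card X : X `<=` C -> X != C -> (#|` X| <= n)%N.
  move=> XC XnC; rewrite -ltnS; apply: leq_trans Cn.
  by apply: fproper_ltn_card; rewrite fproperEneq XnC.
have [bC'|bC'] := boolP (b \in C').
  apply: (IH C') => //; [exact: lt_card|exact: fsubset_trans CD|].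
  move=> x y xC' /fsetDP[yD yC']; have [yC|yC] := boolP (y \in C).
    by apply: C'orth => //; rewrite inE yC'.
  by apply: Corth; [apply: (fsubsetP C'C)|rewrite inE yC].
have DC : C `\` C' `<=` C by apply: fsubsetDl.
apply: (IH (C `\` C')); rewrite ?inE ?bC' ?bC //.
- apply: lt_card => //; apply: contraNneq C'0 => E.
  apply/negPn/negP => /fset0Pn[x xC']; have := fsubsetP C'C x xC'.
  by rewrite -E inE xC'.
- exact: fsubset_trans CD.
move=> x y /fsetDP[xC xC'] /fsetDP[yD]; rewrite inE negb_and negbK.
have [yC' _|_ /= yC] := boolP (y \in C'); last by apply: Corth; rewrite // inE yC.
by rewrite ipC; apply: C'orth; rewrite // inE xC' xC.
Qed.

(** A component is the parabolic subsystem of the simple roots it contains. *)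
Lemma component_parabolic D P C : root_system ip D -> simple_roots D P ->
  irreducible_component ip D C -> C = [fset b in D | b \in <<C `&` P>>%VS].
Proof.
move=> HD HP [CD _ Corth].
have split b : b \in D -> b \in <<C `&` P>>%VS \/ b \in <<P `\` (C `&` P)>>%VS.
  apply: (root_split HD HP); first exact: fsubsetIr.
  move=> x y /fsetIP[xC _] /fsetDP[yP yC]; apply: Corth => //.
  move: yC; rewrite !inE yP andbT => ->.
  by rewrite (simple_root HP).
apply/fsetP => b; rewrite !inE /=; apply/idP/andP => [bC|[bD bS]].
  have bD := fsubsetP CD b bC; split=> //.
  have [//|bT] := split b bD.
  suff /ip_eq0 b0 : ip b b = 0 by have := root_neq0 HD bD; rewrite b0 eqxx.
  apply: span_orth bT => y /fsetDP[yP yC]; rewrite ipC; apply: Corth => //.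
  by move: yC; rewrite !inE yP andbT => ->; rewrite (simple_root HP).
apply/negPn/negP => bC.
suff /ip_eq0 b0 : ip b b = 0 by have := root_neq0 HD bD; rewrite b0 eqxx.
apply: span_orth bS => y /fsetIP[yC yP]; apply: Corth => //.
by rewrite inE bC.
Qed.

(** Since the highest root is dominant, the roots orthogonal to it form the
    standard parabolic subsystem of the simple roots orthogonal to it. *)
Lemma highest_orth_parabolic D P t : root_system ip D -> simple_roots D P ->
  is_highest_root D P t ->
  [fset b in D | ip b t == 0] =
  [fset b in D | b \in <<[fset a in P | ip a t == 0%R]>>%VS].
Proof.
move=> HD HP tH; have fP := simple_free HP.
apply/fsetP => b; rewrite !inE /=; apply: andb_id2l => bD.
apply/idP/idP => [/eqP bt|bS]; last first.
  by apply/eqP; apply: span_orth bS => a; rewrite !inE => /andP[_ /eqP].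
suff pos c : nat_span P c -> ip c t = 0 -> c \in <<[fset a in P | ip a t == 0%R]>>%VS.
  have [bP|bP] := root_sign HP bD; first exact: pos.
  by rewrite -memvN; apply: pos => //; rewrite ipNl bt oppr0.
move=> cP ct; rewrite (cf_span fP (nat_span_span cP)) big_seq_cond.
apply: rpred_sum => a /andP[aP _].
have [at0|at0] := eqVneq (ip a t) 0.
  by rewrite memvZ // memv_span // !inE aP at0 eqxx.
suff -> : cf P a c = 0 by rewrite scale0r mem0v.
move: ct; rewrite (cf_span fP (nat_span_span cP)) ip_suml big_seq => /eqP.
rewrite psumr_eq0 => [/allP /(_ a aP)|x xP]; last first.
  by rewrite ipZl mulr_ge0 ?(nat_span_cf_ge0 HP) // ipC (highest_dominant HD HP tH).
by rewrite aP ipZl mulf_eq0 (negPf at0) orbF -(cf_span fP (nat_span_span cP)) => /eqP.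
Qed.

End Components.

(** * Coroot lattice and orthogonal roots *)

Section CorootLattice.
Variables (R : realType) (V : vectType R) (ip : {dot V for idfun}).
Variable D : {fset V}.
Hypothesis HD : root_system ip D.
Implicit Types (a b t u v tau : V) (ts : seq V).

Lemma lattice0 : coroot_lattice ip D 0.
Proof. by exists (fun=> 0); rewrite big1 // => a _; rewrite mulr0z. Qed.

Lemma latticeD u v : coroot_lattice ip D u -> coroot_lattice ip D v ->
  coroot_lattice ip D (u + v).
Proof.
case=> c -> [d ->]; exists (fun a => c a + d a).
by rewrite -big_split; apply: eq_bigr => a _; rewrite mulrzDr.
Qed.

Lemma latticeN u : coroot_lattice ip D u -> coroot_lattice ip D (- u).
Proof.
case=> c ->; exists (fun a => - c a).
by rewrite -sumrN; apply: eq_bigr => a _; rewrite mulrNz.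
Qed.

Lemma lattice_coroot a : a \in D -> coroot_lattice ip D (coroot ip a).
Proof.
move=> aD; exists (fun b => (b == a)%:Z).
rewrite (bigD1_seq a) ?fset_uniq //= eqxx mulr1z big1 ?addr0// => b /negPf ->.
by rewrite mulr0z.
Qed.

Lemma lattice_sum (I : eqType) (r : seq I) (F : I -> V) :
  (forall i, i \in r -> F i \in D) ->
  coroot_lattice ip D (\sum_(i <- r) coroot ip (F i)).
Proof.
move=> rD; rewrite big_seq; apply: (big_ind (coroot_lattice ip D)) => [||i /rD].
- exact: lattice0.
- exact: latticeD.
- exact: lattice_coroot.
Qed.

Lemma lattice_int v b : coroot_lattice ip D v -> b \in D -> ip v b \is a Num.int.
Proof.
case=> c -> bD; rewrite ip_suml big_seq_cond rpred_sum // => a /andP[aD _].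
by rewrite ipC ipMz rpredM ?intr_int ?(root_int HD).
Qed.

(** Every element v of the coroot lattice whose pairings with all roots are at
    most 1 is 0. Otherwise, writing v as an integral combination of coroots, a
    reflection decreases the sum of the absolute values of the coefficients,
    and preserves the norm and the condition on the pairings. *)
Lemma lattice_small_eq0 v : coroot_lattice ip D v ->
  (forall b, b \in D -> ip v b <= 1) -> v = 0.
Proof.
case=> n vE small.
suff main N : forall n v, (\sum_(a <- D) `|n a|%N <= N)%N ->
    v = \sum_(a <- D) coroot ip a *~ n a ->
    (forall b, b \in D -> ip v b <= 1) -> v = 0.
  exact: (main _ n v (leqnn _)).
elim: N => {vE small v n} [|N IH] n v nN vE small.
  rewrite vE big_seq big1 // => a aD; suff -> : n a = 0 by rewrite mulr0z.
  move: nN; rewrite leqn0 (bigD1_seq a) ?fset_uniq //= addn_eq0 absz_eq0.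
  by move=> /andP[/eqP].
apply: contrapT => /eqP v0.
have vL : coroot_lattice ip D v by exists n.
(* Some root occurs in the combination with the sign of its pairing with v. *)
have [a aD na] : exists2 a, a \in D & 0 < (n a)%:~R * ip v (coroot ip a).
  apply: contrapT => none; have := ip_gt0 ip v0; rewrite {2}vE ip_sumr big_seq_cond.
  apply/negP; rewrite -leNgt; apply: sumr_le0 => a /andP[aD _].
  rewrite leNgt; apply/negP => h; apply: none; exists a => //.
  by rewrite -ipMz.
have a0 := root_neq0 HD aD.
have rE : reflection ip a v = v - ip v a *: coroot ip a.
  by rewrite /reflection /coroot ipZr !scalerA; congr (_ - _ *: _); ring.
have smallN b : b \in D -> -1 <= ip v b.
  by move=> bD; rewrite lerNl -ipNr small // (root_opp HD).
have va0 : ip v a != 0.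
  by rewrite -(coroot_eq0 ip v a0); apply: contraTneq na => ->; rewrite mulr0 ltxx.
(* e is the sign of the pairing; it has the sign of n a. *)
have [e [eE e1 ne]] : exists e : int,
    [/\ ip v a = e%:~R, e = 1 \/ e = -1 & 0 < n a * e].
  have /intrP[e eE] := lattice_int vL aD; exists e.
  have := small a aD; have := smallN a aD.
  rewrite eE -[1]/(1%:~R) -rmorphN /= !ler_int => em ep.
  have e0 : e != 0 by apply: contraNneq va0 => e0; rewrite eE e0.
  have e1 : e = 1 \/ e = -1 by lia.
  split=> //; rewrite -(ltr0z R) rmorphM /= -eE.
  have [nneg|npos] := leP (n a) 0.
    have nR : (n a)%:~R <= 0 :> R by rewrite lerz0.
    have vn : ip v (coroot ip a) < 0.
      by rewrite ltNge; apply/negP => h; have := mulr_le0_ge0 nR h; rewrite leNgt na.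
    rewrite coroot_lt0 // in vn; rewrite nmulr_lgt0 // lt_neqAle nR andbT.
    by apply: contraTneq na => ->; rewrite mul0r ltxx.
  have nR : 0 < (n a)%:~R :> R by rewrite ltr0z.
  by move: na; rewrite !pmulr_rgt0 // coroot_gt0.
pose m b := n b - (if b == a then e else 0).
have : reflection ip a v = 0.
  apply: (IH m).
  - rewrite -ltnS; apply: leq_trans nN.
    rewrite (bigD1_seq a) ?fset_uniq //= [X in (_ < X)%N](bigD1_seq a) ?fset_uniq //=.
    rewrite -addSn leq_add //; first by rewrite /m eqxx; lia.
    by apply: leq_sum => b /negPf ba; rewrite /m ba subr0.
  - rewrite rE eE {1}vE scaler_int (bigD1_seq a) ?fset_uniq //=.
    rewrite [RHS](bigD1_seq a) ?fset_uniq //= {1}/m eqxx mulrzBr addrAC; congr (_ + _).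
    by apply: eq_bigr => b /negPf ba; rewrite /m ba subr0.
  - move=> b bD; have rD := root_reflection HD aD bD.
    rewrite -[reflection _ _ _]/(v - ip v (coroot ip a) *: a).
    have -> : ip (v - ip v (coroot ip a) *: a) b = ip v (b - ip b (coroot ip a) *: a).
      by rewrite !ip_coroot ipBl ipBr ipZl ipZr (ipC ip a b); ring.
    exact: small.
by move=> r0; have := ip_gt0 ip v0; rewrite -(ip_reflection ip v v a0) r0 ip0l ltxx.
Qed.

(** Reflecting b successively in pairwise orthogonal roots. *)
Lemma orth_reflections ts b : {subset ts <= D} ->
  pairwise (fun x y => ip x y == 0) ts ->
  b \in D -> b - \sum_(t <- ts) ip b (coroot ip t) *: t \in D.
Proof.
move=> + + bD; elim: ts => [|t ts IH] tsD /=; first by rewrite big_nil subr0.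
move=> /andP[/allP torth pw]; rewrite big_cons.
have tD : t \in D by apply: tsD; rewrite inE eqxx.
have tsD' : {subset ts <= D} by move=> x xs; apply: tsD; rewrite inE xs orbT.
have := root_reflection HD tD (IH tsD' pw).
rewrite ipBl ip_suml; set r := \sum_(x <- ts) ip (_ *: _) _.
have -> : r = 0.
  rewrite /r big_seq big1 // => x xs.
  by rewrite ipZl [ip x _]ip_coroot (ipC ip x t) (eqP (torth x xs)) mulr0 mul0r mulr0.
by rewrite subr0 -addrA -opprD [X in _ - X]addrC.
Qed.

Section Bounded.
Variables (tau : V) (ts : seq V).
Hypotheses (tau2 : forall b, b \in D -> ip tau b <= 2)
  (tsD : {subset ts <= D}) (tsO : pairwise (fun x y => ip x y == 0) ts)
  (ts2 : forall t, t \in ts -> ip tau t = 2).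

Lemma tau_geN2 b : b \in D -> -2 <= ip tau b.
Proof. by move=> bD; rewrite lerNl -ipNr tau2 // (root_opp HD). Qed.

(** The reflection of b in the roots of ts is again a root, on which tau is at
    most 2 in absolute value. *)
Lemma orth_coroot_bound b : b \in D ->
  -2 <= ip tau b - 2 * \sum_(t <- ts) ip b (coroot ip t) <= 2.
Proof.
move=> bD; have rD := orth_reflections tsD tsO bD.
have := tau2 rD; have := tau_geN2 rD; rewrite ipBr ip_sumr.
suff -> : \sum_(t <- ts) ip tau (ip b (coroot ip t) *: t) =
  2 * \sum_(t <- ts) ip b (coroot ip t) by move=> -> ->.
rewrite mulr_sumr big_seq [RHS]big_seq; apply: eq_bigr => t tts.
by rewrite ipZr ts2 // mulrC.
Qed.

End Bounded.

(** If the pairings of tau with the roots are at most 2 and equal 2 on pairwise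
    orthogonal roots ts, then tau is either the sum of their coroots or equal
    to 2 on a further root orthogonal to all of them. *)
Lemma next_orth_root tau ts : coroot_lattice ip D tau ->
  (forall b, b \in D -> ip tau b <= 2) -> {subset ts <= D} ->
  pairwise (fun x y => ip x y == 0) ts -> (forall t, t \in ts -> ip tau t = 2) ->
  tau <> \sum_(t <- ts) coroot ip t ->
  exists b, [/\ b \in D, ip tau b = 2 & forall t, t \in ts -> ip b t = 0].
Proof.
move=> tauL tau2 tsD tsO ts2 ne.
have rL : coroot_lattice ip D (tau - \sum_(t <- ts) coroot ip t).
  by apply: latticeD => //; apply: latticeN; apply: lattice_sum.
have [b bD b1] : exists2 b, b \in D & 1 < ip (tau - \sum_(t <- ts) coroot ip t) b.
  apply: contrapT => none; apply: ne; apply/eqP; rewrite -subr_eq0; apply/eqP.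
  apply: lattice_small_eq0 rL _ => b bD; rewrite leNgt; apply/negP => h.
  by apply: none; exists b.
have := int_ltD1 (rpred1 _) (lattice_int rL bD) b1.
rewrite ipBl ip_suml; under eq_bigr => t _ do rewrite ipC.
have tb := tau2 b bD; have := orth_coroot_bound tau2 tsD tsO ts2 bD.
set s := \sum_(t <- ts) _ => /andP[s1 s2] h.
have t2 : ip tau b = 2 by lra.
have s0 : s = 0 by lra.
exists b; split=> // t tts.
have ge0 x : x \in ts -> 0 <= ip b (coroot ip x).
  move=> xts; have := @orth_coroot_bound tau [:: x] tau2 _ _ _ b bD.
  rewrite big_seq1 t2 => /(_ _ _ _)/andP[]; last by lra.
  - by move=> y; rewrite inE => /eqP ->; apply: tsD.
  - by [].
  - by move=> y; rewrite inE => /eqP ->; apply: ts2.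
move/eqP: s0; rewrite /s big_seq psumr_eq0 => [/allP /(_ t tts)|//].
by rewrite tts coroot_eq0 ?(root_neq0 HD) ?tsD // => /eqP.
Qed.

End CorootLattice.

(** * Irreducible parabolic subsystems and steps of a chain *)

Section StandardParabolics.
Variables (R : realType) (V : vectType R) (ip : {dot V for idfun}).
Variables (Delta Pi : {fset V}).
Hypotheses (HD : root_system ip Delta) (HP : simple_roots Delta Pi).
Implicit Types (a b t u v g tau : V) (C : {fset V}).

Notation th := (sub_highest_root Pi).

(** An irreducible standard parabolic subsystem of Delta. *)
Definition irr_parabolic C := standard_parabolic Delta Pi C /\ irreducible_roots ip C.

(** The relation between two consecutive members of a chain: C' is a component
    of the orthogonal of the highest root of C. *)
Definition chain_step C C' :=
  irreducible_component ip [fset b in C | ip b (th C) == 0] C'.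

Section OneParabolic.
Variable C : {fset V}.
Hypothesis HC : irr_parabolic C.

Lemma irr_parabolicE : C = [fset b in Delta | b \in <<C `&` Pi>>%VS].
Proof. by case: HC => [[P PPi ->] _]; rewrite (parabolic_simple HP PPi). Qed.

Lemma irr_parabolic_sub : C `<=` Delta.
Proof. by rewrite irr_parabolicE; apply: fset_sub. Qed.

Lemma irr_parabolic_root_system : root_system ip C.
Proof. by rewrite irr_parabolicE; apply: parabolic_root_system. Qed.

Lemma irr_parabolic_simple_roots : simple_roots C (C `&` Pi).
Proof.
rewrite {1}irr_parabolicE.
exact: (parabolic_simple_roots HP (fsubsetIr C Pi)).
Qed.

Lemma irr_parabolic_highest : is_highest_root C (C `&` Pi) (th C).
Proof.
case: HC => _.
exact: highest_rootP irr_parabolic_root_system irr_parabolic_simple_roots.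
Qed.

Lemma highest_in : th C \in C.
Proof. by case: irr_parabolic_highest. Qed.

Lemma highest_neq0 : th C != 0.
Proof. exact: (root_neq0 irr_parabolic_root_system highest_in). Qed.

Lemma highest_in_Delta : th C \in Delta.
Proof. exact: (fsubsetP irr_parabolic_sub _ highest_in). Qed.

Lemma highest_simple_ge0 a : a \in C -> a \in Pi -> 0 <= ip a (th C).
Proof.
move=> aC aPi; rewrite ipC; apply: (highest_dominant irr_parabolic_root_system
  irr_parabolic_simple_roots irr_parabolic_highest).
by rewrite inE aC.
Qed.

Lemma outer_simple_le0 a b : a \in Pi -> a \notin C -> b \in C `&` Pi -> ip a b <= 0.
Proof.
move=> aPi aC /fsetIP[bC bPi]; apply: (simple_le0 HD HP) => //.
by apply: contraNneq aC => ->.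
Qed.

(** A simple root outside C is nonpositive on the simple roots of C, hence it
    is at its lowest on the highest root of C. *)
Lemma outer_highest_le a g : a \in Pi -> a \notin C -> g \in C -> ip a (th C) <= ip a g.
Proof.
move=> aPi aC gC; rewrite -lerN2 -!ipNl.
apply: (highest_ge irr_parabolic_highest) => //.
by move=> b bC; rewrite ipNl oppr_ge0 outer_simple_le0.
Qed.

(** A simple root outside C that is attached to C is negative on the highest
    root of C. *)
Lemma outer_highest_lt0 a g : a \in Pi -> a \notin C -> g \in C -> ip a g != 0 ->
  ip a (th C) < 0.
Proof.
move=> aPi aC gC ag.
have h1 := outer_highest_le aPi aC gC.
have h2 := outer_highest_le aPi aC (root_opp irr_parabolic_root_system gC).
move: h2; rewrite ipNr.
by have [?|?|E] := ltgtP (ip a g) 0; last (by rewrite E eqxx in ag); lra.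
Qed.

Lemma highest_long : (exists2 a, a \in C & long_root ip Delta a) ->
  forall b, b \in Delta -> ip b b <= ip (th C) (th C).
Proof.
move=> [a aC [_ along]] b bD; apply: le_trans (along b bD) _.
exact: (highest_longest irr_parabolic_root_system irr_parabolic_simple_roots
  irr_parabolic_highest aC).
Qed.

End OneParabolic.

Section OneStep.
Variables C C' : {fset V}.
Hypotheses (HC : irr_parabolic C) (CC' : chain_step C C').

Lemma step_sub : C' `<=` C.
Proof. by case: CC' => h _ _; apply: fsubset_trans h (fset_sub _ _). Qed.

Lemma step_orth g : g \in C' -> ip g (th C) = 0.
Proof. by case: CC' => /fsubsetP h _ _ /h; rewrite !inE /= => /andP[_ /eqP]. Qed.

Lemma step_notin : th C \notin C'.
Proof.
apply/negP => /step_orth /ip_eq0 h.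
by have := highest_neq0 HC; rewrite h eqxx.
Qed.

Lemma step_split a : a \in C -> a \notin C' -> ip a (th C) = 0 ->
  forall g, g \in C' -> ip a g = 0.
Proof.
case: CC' => _ _ orth aC aC' a0 g gC'; rewrite ipC; apply: orth => //.
by rewrite !inE aC' aC a0 eqxx.
Qed.

Lemma step_parabolic : irr_parabolic C'.
Proof.
have [CD irr _] := CC'; split => //.
have rC := irr_parabolic_root_system HC; have sC := irr_parabolic_simple_roots HC.
have hC := irr_parabolic_highest HC.
pose P' := [fset a in C `&` Pi | ip a (th C) == 0].
have P'sub : P' `<=` C `&` Pi by apply: fset_sub.
have E := highest_orth_parabolic rC sC hC.
have CC'2 := CC'; rewrite /chain_step E in CC'2.
have C'E := component_parabolic (parabolic_root_system _ rC)
  (parabolic_simple_roots sC P'sub) CC'2.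
exists (C' `&` P').
  by apply: fsubset_trans (fsubsetIr _ _) (fsubset_trans P'sub (fsubsetIr _ _)).
rewrite {1}C'E; apply/fsetP => b; rewrite !inE /=; apply/idP/idP => /andP[].
  by move=> /andP[bC _] ->; rewrite (fsubsetP (irr_parabolic_sub HC)).
move=> bD bS; rewrite bS andbT.
have bP' : b \in <<P'>>%VS.
  by apply: subvP bS; apply: sub_span => x /fsetIP[].
rewrite bP' andbT (irr_parabolicE HC) !inE /= bD.
by apply: subvP bP'; apply: sub_span => x /(fsubsetP P'sub).
Qed.

Let HC' := step_parabolic.

Lemma step_simple_neq0 : C' `&` Pi != fset0.
Proof.
apply/negP => /eqP E.
have := root_span (irr_parabolic_simple_roots HC') (highest_in HC').
by rewrite E span_nil memv0 (negPf (highest_neq0 HC')).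
Qed.

(** The next member is attached, in the Dynkin diagram of C, to some simple
    root outside of it, because this diagram is connected. *)
Lemma step_attached : exists a, [/\ a \in C, a \in Pi, a \notin C' & ip a (th C') < 0].
Proof.
apply: contrapT => none.
have SC : C' `&` Pi = C `&` Pi.
  apply: (irr_split (irr_parabolic_root_system HC) (irr_parabolic_simple_roots HC)).
  - by case: HC.
  - by apply: fsetSI; apply: step_sub.
  - exact: step_simple_neq0.
  move=> a b /fsetIP[aC' aPi] /fsetDP[/fsetIP[bC bPi] bC'].
  have nbC' : b \notin C' by move: bC'; rewrite !inE bPi andbT.
  apply: contrapT => /eqP ab; apply: none; exists b; split=> //.
  by apply: outer_highest_lt0 HC' _ _ _ _ aC' _ => //; rewrite ipC.
have E : C' = C by rewrite (irr_parabolicE HC') SC -(irr_parabolicE HC).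
by have := step_notin; rewrite E highest_in.
Qed.

Lemma attached_highest_gt0 a g : a \in C -> a \in Pi -> a \notin C' -> g \in C' ->
  ip a g != 0 -> 0 < ip a (th C).
Proof.
move=> aC aPi aC' gC' ag; rewrite lt_def highest_simple_ge0 // andbT.
by apply: contraNneq ag => a0; apply/eqP/step_split.
Qed.

(** Every simple root of C not orthogonal to the highest root is attached to
    every component of the orthogonal. Otherwise another such simple root a' is
    attached, both have coefficient 1 in the highest root, and removing a' from
    the highest root gives a root with disconnected support. *)
Lemma step_all_attached a : a \in C -> a \in Pi -> 0 < ip a (th C) -> ip a (th C') < 0.
Proof.
move=> aC aPi at0.
have rC := irr_parabolic_root_system HC; have sC := irr_parabolic_simple_roots HC.
have hC := irr_parabolic_highest HC; have fC := simple_free sC.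
have thC := highest_in HC.
have aC' : a \notin C' by apply/negP => /step_orth h; rewrite h ltxx in at0.
rewrite ltNge; apply/negP => ath.
have aorth g : g \in C' -> ip a g = 0.
  move=> gC'; apply/eqP; apply: contraLR ath => ag; rewrite -ltNge.
  exact: outer_highest_lt0 ag.
have [a' [a'C a'Pi a'C' a'th]] := step_attached.
have aa' : a != a' by apply: contraTneq a'th => <-; rewrite aorth ?ltxx // highest_in.
have a't0 : 0 < ip a' (th C).
  by apply: attached_highest_gt0 (highest_in HC') _ => //; rewrite lt_eqF.
have aS : a \in C `&` Pi by rewrite inE aC.
have a'S : a' \in C `&` Pi by rewrite inE a'C.
(* The f x are nonnegative and sum to (t, t^) = 2, where t is the highest root;
   f a and f a' are at least 1, which leaves nothing for the others. *)
pose f x := cf (C `&` Pi) x (th C) * ip x (coroot ip (th C)).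
have th2 : \sum_(x <- C `&` Pi) f x = 2.
  rewrite -(coroot_self ip (highest_neq0 HC)).
  rewrite [X in _ = ip X _](cf_span fC (root_span sC thC)) ip_suml.
  by apply: eq_bigr => x _; rewrite ipZl.
have cf1 x : x \in C `&` Pi -> 1 <= cf (C `&` Pi) x (th C).
  exact: (highest_cf_ge1 sC hC).
have f0 x : x \in C `&` Pi -> 0 <= f x.
  move=> xS; have := cf1 x xS => h; rewrite mulr_ge0 //; first by lra.
  have /fsetIP[xC xPi] := xS; rewrite leNgt coroot_lt0 ?highest_neq0 // -leNgt.
  exact: highest_simple_ge0.
have fa : 1 <= f a by rewrite mulr_ege1 ?cf1 ?(coroot_ge1 rC).
have k1 : 1 <= ip a' (coroot ip (th C)) by apply: (coroot_ge1 rC).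
have fa'k : cf (C `&` Pi) a' (th C) <= f a'.
  by rewrite ler_peMr //; have := cf1 a' a'S; lra.
have fx x : x \in C `&` Pi -> x != a -> x != a' -> f a + (f a' + f x) <= 2.
  move=> xS xa xa'; rewrite -th2.
  have := @ler_sum_sub _ _ [:: a; a'; x] (C `&` Pi) f _ _ f0.
  rewrite !big_cons big_nil addr0; apply.
    by rewrite /= !inE negb_or aa' eq_sym xa eq_sym xa'.
  by apply/allP => /=; rewrite aS a'S xS.
have faa' : f a + f a' <= 2.
  rewrite -th2; have := @ler_sum_sub _ _ [:: a; a'] (C `&` Pi) f _ _ f0.
  rewrite !big_cons big_nil addr0; apply; first by rewrite /= !inE aa'.
  by apply/allP => /=; rewrite aS a'S.
have cfa' : cf (C `&` Pi) a' (th C) = 1 by have := cf1 a' a'S; lra.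
have other x : x \in C `&` Pi -> x != a -> x != a' -> ip x (th C) = 0.
  move=> xS xa xa'; apply/eqP; rewrite -(coroot_eq0 _ _ (highest_neq0 HC)).
  have /eqP : f x = 0 by have := fx x xS xa xa'; have := f0 x xS; lra.
  by rewrite mulf_eq0 gt_eqF //; apply: lt_le_trans (cf1 x xS).
have ta' : th C != a'.
  apply: contraTneq a'th => <-; rewrite -leNgt ipC step_orth ?lexx //.
  exact: highest_in.
have gC : th C - a' \in C by apply: (root_sub rC) => //; rewrite ipC.
(* t - a' has no coordinate on a', and the remaining simple roots split into
   those of C' and those orthogonal to C'. *)
pose Q := (C `&` Pi) `\ a'.
have QS : Q `<=` C `&` Pi by apply: fsubD1set.
have gQ : th C - a' \in <<Q>>%VS.
  rewrite (cf_span fC (root_span sC gC)) big_seq_cond.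
  apply: rpred_sum => x /andP[xS _]; have [->|xa'] := eqVneq x a'.
    by rewrite cfB cfa' (cf_mem fC a'S a'S) eqxx /= subrr scale0r mem0v.
  by rewrite memvZ // memv_span // in_fsetD1 xa'.
have gin : th C - a' \in [fset b in C | b \in <<Q>>%VS] by rewrite !inE /= gC gQ.
have C'Q : C' `&` Pi `<=` Q.
  apply/fsubsetP => x /fsetIP[xC' xPi].
  rewrite in_fsetD1 inE (fsubsetP step_sub) // xPi !andbT.
  by apply: contraNneq a'C' => <-.
have cfg x : x \in C `&` Pi -> x != a' -> 1 <= cf (C `&` Pi) x (th C - a').
  move=> xS xa'; rewrite cfB (cf_mem fC xS a'S) (negPf xa') subr0; exact: cf1.
have [|gS|gS] := root_split (parabolic_root_system Q rC)
  (parabolic_simple_roots sC QS) C'Q _ gin.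
- move=> x y /fsetIP[xC' xPi]; rewrite !inE => /andP[yC' /and3P[ya' yC yPi]].
  have nyC' : y \notin C' by move: yC'; rewrite yPi andbT.
  rewrite ipC; have [->|ya] := eqVneq y a; first exact: aorth.
  by apply: step_split xC' => //; apply: other; rewrite // inE yC.
- have := cfg a aS aa'.
  rewrite (cf_out fC (fsubset_trans C'Q QS) aS _ gS); first by lra.
  by rewrite inE negb_and aC'.
- have /fset0Pn[x xS'] := step_simple_neq0.
  have xQ := fsubsetP C'Q x xS'; have := xQ; rewrite in_fsetD1 => /andP[xa' xS].
  have := cfg x xS xa'.
  rewrite (cf_out fC (fsubset_trans (fsubsetDl _ _) QS) xS _ gS); first by lra.
  by rewrite inE xS'.
Qed.

End OneStep.

End StandardParabolics.

(** * Dominant elements of twice the alcove *)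

Section Tau.
Variables (R : realType) (V : vectType R) (ip : {dot V for idfun}).
Variables (Delta Pi : {fset V}).
Hypotheses (HD : root_system ip Delta) (HI : irreducible_roots ip Delta)
  (HP : simple_roots Delta Pi).
Implicit Types (a b t u v g : V) (C : {fset V}).

Notation th := (sub_highest_root Pi).
Notation irr_parabolic := (irr_parabolic ip Delta Pi).
Notation chain_step := (chain_step ip Pi).

Lemma Delta_parabolic : irr_parabolic Delta.
Proof.
split=> //; exists Pi => //; apply/fsetP => b; rewrite !inE /=.
by case bD: (b \in Delta) => //=; rewrite (root_span HP).
Qed.

Lemma Delta_simple : Delta `&` Pi = Pi.
Proof. by apply/fsetIidPr; case: HP. Qed.

Lemma Delta_highest : th Delta = highest_root Delta Pi.
Proof. by rewrite /sub_highest_root Delta_simple. Qed.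

Section Converse.
Variable tau : V.
Hypothesis tauX : X ip Delta Pi tau.

Lemma tau_ge0 a : a \in Pi -> 0 <= ip tau a.
Proof. by case: tauX => _ + _; apply. Qed.

Lemma tau_le2 b : b \in Delta -> ip tau b <= 2.
Proof.
move=> bD; case: tauX => _ tau0; apply: le_trans.
exact: (highest_ge (highest_rootP HD HP HI)).
Qed.

(** If the dominant vector tau takes its maximal value 2 on the highest root of
    C, it vanishes on the simple roots outside C, because these all occur in the
    difference between the highest roots of Delta and C. *)
Lemma tau_outer C a : irr_parabolic C -> ip tau (th C) = 2 -> a \in Pi -> a \notin C ->
  ip tau a = 0.
Proof.
move=> HC tC aPi aC; set t := highest_root Delta Pi.
have [tD tge] : is_highest_root Delta Pi t by apply: (highest_rootP HD HP HI).
have dP := tge _ (highest_in_Delta HD HP HC).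
have tau_d : ip tau (t - th C) <= 0 by rewrite ipBr tC subr_le0 tau_le2.
have fP := simple_free HP.
have cfa : 1 <= cf Pi a (t - th C).
  rewrite cfB (@cf_out _ _ Pi (C `&` Pi) a (th C)) ?subr0 //.
  - by apply: (highest_cf_ge1 HP).
  - exact: fsubsetIr.
  - by rewrite inE (negPf aC).
  - apply: (root_span (irr_parabolic_simple_roots HP HC)); exact: (highest_in HD HP HC).
have term x : x \in Pi -> 0 <= cf Pi x (t - th C) * ip tau x.
  by move=> xPi; rewrite mulr_ge0 ?tau_ge0 ?(nat_span_cf_ge0 HP).
have := @ler_sum_sub _ _ [:: a] Pi (fun x => cf Pi x (t - th C) * ip tau x).
rewrite big_seq1 => /(_ isT _ term) h.
have ta : cf Pi a (t - th C) * ip tau a <= 0.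
  apply: le_trans tau_d; rewrite {2}(cf_span fP (nat_span_span dP)) ip_sumr.
  under [leRHS]eq_bigr => x _ do rewrite ipZr.
  by apply: h; apply/allP; rewrite /= aPi.
apply: le_anti; rewrite tau_ge0 // andbT.
by move: ta; rewrite pmulr_rle0 //; lra.
Qed.

Lemma tau_orth_bound2 t1 t2 b : t1 \in Delta -> t2 \in Delta -> ip t1 t2 = 0 ->
  ip tau t1 = 2 -> ip tau t2 = 2 -> b \in Delta ->
  -2 <= ip tau b - 2 * (ip b (coroot ip t1) + ip b (coroot ip t2)) <= 2.
Proof.
move=> t1D t2D t12 tau1 tau2 bD.
have := @orth_coroot_bound _ _ _ _ HD tau [:: t1; t2] tau_le2 _ _ _ b bD.
rewrite !big_cons big_nil addr0; apply => //=; first by apply/allP; rewrite /= t1D t2D.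
  by rewrite t12 eqxx.
by move=> t; rewrite !inE => /orP[] /eqP ->.
Qed.

Lemma tau_orth_bound1 t b : t \in Delta -> ip tau t = 2 -> b \in Delta ->
  -2 <= ip tau b - 2 * ip b (coroot ip t) <= 2.
Proof.
move=> tD tau1 bD.
have := @orth_coroot_bound _ _ _ _ HD tau [:: t] tau_le2 _ _ _ b bD.
rewrite big_seq1; apply => //=; first by apply/allP; rewrite /= tD.
by move=> x; rewrite !inE => /eqP ->.
Qed.

Section Step.
Variables C C' : {fset V}.
Hypotheses (HC : irr_parabolic C) (CC' : chain_step C C')
  (tC : ip tau (th C) = 2) (tC' : ip tau (th C') = 2).
Let HC' : irr_parabolic C' := step_parabolic HD HP HC CC'.
Let tD := highest_in_Delta HD HP HC.
Let t'D := highest_in_Delta HD HP HC'.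

(** A root orthogonal to the highest root of C on which tau is 2 has to lie in
    C': tau vanishes on all other components of the orthogonal. *)
Lemma tau_step_in b : b \in C -> ip b (th C) = 0 -> ip tau b = 2 -> b \in C'.
Proof.
move=> bC bt tb; apply/negPn/negP => bC'.
have rC := irr_parabolic_root_system HD HP HC.
have sC := irr_parabolic_simple_roots HP HC.
have hC := irr_parabolic_highest HD HP HC.
pose P' := [fset a in C `&` Pi | ip a (th C) == 0].
have P'sub : P' `<=` C `&` Pi by apply: fset_sub.
have E := highest_orth_parabolic rC sC hC.
have bP' : b \in [fset x in C | x \in <<P'>>%VS].
  by rewrite -E !inE /= bC bt eqxx.
have [||bS|bS] := root_split (S := C' `&` P') (parabolic_root_system P' rC)
  (parabolic_simple_roots sC P'sub) _ _ bP'.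
- exact: fsubsetIr.
- move=> x y /fsetIP[xC' _]; rewrite !inE /= => /andP[+ /andP[/andP[yC yPi] y0]].
  rewrite yC yPi y0 !andbT => yC'; rewrite ipC.
  by apply: (step_split CC') xC' => //; apply/eqP.
- case/negP: bC'; rewrite (irr_parabolicE HP HC') !inE /=.
  rewrite (fsubsetP (irr_parabolic_sub HP HC)) //=.
  apply: subvP bS; apply: sub_span => x /fsetIP[xC' xP'].
  by rewrite inE xC'; move: (fsubsetP P'sub x xP'); rewrite inE => /andP[].
suff : ip b tau = 0 by rewrite ipC tb; lra.
apply: span_orth bS => x; rewrite !inE /= => /andP[+ /andP[/andP[xC xPi] x0]].
rewrite xC xPi x0 !andbT => xC'.
by rewrite ipC; apply: tau_outer HC' _ _ _.
Qed.

(** If the highest root t of C is long, then so is some root of C'. A simple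
    root a of C attached to C' pairs to 1 with t and to -1 with the highest
    root t' of C'. Either t - 2a is a long root of C', or a is long and the
    integrality of its pairing with t' makes t' long as well. *)
Lemma tau_step_long : (forall b, b \in Delta -> ip b b <= ip (th C) (th C)) ->
  exists2 a, a \in C' & long_root ip Delta a.
Proof.
move=> tlong.
have [a [aC aPi aC' at']] := step_attached HD HP HC CC'.
have aD := fsubsetP (irr_parabolic_sub HP HC) a aC.
have t'C' := highest_in HD HP HC'.
have ta : ip tau a = 0 by apply: tau_outer HC' _ _ _.
have at0 : 0 < ip a (th C).
  by apply: (attached_highest_gt0 HD HP HC CC') t'C' _ => //; rewrite lt_eqF.
have t0 := highest_neq0 HD HP HC; have t'0 := highest_neq0 HD HP HC'.
have a0 := root_neq0 HD aD.
have e1 : ip a (coroot ip (th C)) = 1.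
  apply: le_anti; rewrite (coroot_ge1 HD) // andbT.
  by have := tau_orth_bound1 tD tC aD; rewrite ta; lra.
have e1' : ip a (coroot ip (th C')) = -1.
  have := coroot_leN1 HD t'D aD at'.
  by have := tau_orth_bound1 t'D tC' aD; rewrite ta; lra.
have tt' : ip (th C) (th C') = 0 by rewrite ipC; apply: (step_orth CC').
set m := ip (th C) (coroot ip a).
have m1 : 1 <= m by apply: (coroot_ge1 HD) => //; rewrite ipC.
have dD : th C - m *: a \in Delta by apply: (root_reflection HD).
have dt' : ip (th C - m *: a) (coroot ip (th C')) = m.
  by rewrite ipBl ipZl e1' [ip (th C) _]ip_coroot tt' mulr0 mul0r; lra.
have m2 : m <= 2.
  have := tau_orth_bound1 t'D tC' dD.
  by rewrite dt' ipBr ipZr tC ta mulr0; lra.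
have at2 : ip a (th C) * 2 = ip (th C) (th C).
  by rewrite mulrC -ip_coroot_mul // e1 mul1r.
have [mgt1|mle1] := ltP 1 m.
  have mE : m = 2.
    apply: le_anti; rewrite m2 /=.
    exact: int_ltD1 (rpred1 _) (root_int HD aD tD) mgt1.
  have dC : th C - m *: a \in C.
    apply: (root_reflection (irr_parabolic_root_system HD HP HC)) => //.
    exact: (highest_in HD HP HC).
  exists (th C - m *: a); last first.
    by split=> // b bD; rewrite ip_reflection //; apply: tlong.
  apply/negPn/negP => dC'.
  have dt0 : ip (th C - m *: a) (th C) = 0 by rewrite ipBl ipZl mE -at2; lra.
  have := step_split CC' dC dC' dt0 t'C' => /eqP.
  by rewrite -(coroot_eq0 _ _ t'0) dt' mE pnatr_eq0.
have mE : m = 1 by apply: le_anti; rewrite mle1.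
have aa : ip a a = ip (th C) (th C).
  by have := ip_coroot_mul ip (th C) a0; rewrite -/m mE ipC; lra.
have n1 : ip (th C') (coroot ip a) <= -1 by apply: (coroot_leN1 HD) => //; rewrite ipC.
have t't' : ip a a <= ip (th C') (th C').
  have := ip_coroot_mul ip (th C') a0; have := ip_coroot_mul ip a t'0.
  rewrite e1' (ipC ip (th C') a) => <- h.
  by have := ler_wpM2r (ip_ge0 ip a) n1; rewrite h; lra.
exists (th C') => //; split=> // b bD.
by apply: le_trans (tlong b bD) _; rewrite -aa.
Qed.

End Step.

End Converse.

End Tau.

(** * Good chains *)

Section Chains.
Variables (R : realType) (V : vectType R) (ip : {dot V for idfun}).
Variables (Delta Pi : {fset V}).
Hypotheses (HD : root_system ip Delta) (HI : irreducible_roots ip Delta)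
  (HP : simple_roots Delta Pi).
Implicit Types (a b t u v g : V) (C : {fset V}) (ch : seq {fset V}).

Notation th := (sub_highest_root Pi).
Notation irr_parabolic := (irr_parabolic ip Delta Pi).
Notation chain_step := (chain_step ip Pi).
Notation good_chain := (good_chain ip Delta Pi).

Section OneChain.
Variable ch : seq {fset V}.
Hypothesis Hch : good_chain ch.
Let D i := nth fset0 ch i.
Let n := size ch.

Lemma chain_size : (0 < n)%N.
Proof. by case: Hch => [[]]. Qed.

Lemma chain0 : D 0 = Delta.
Proof. by case: Hch => [[]]. Qed.

Lemma chain_parabolic i : (i < n)%N -> irr_parabolic (D i).
Proof. by case: Hch => [[_ _ +] _ _ _]; apply. Qed.

Lemma chain_stepP i : (i.+1 < n)%N -> chain_step (D i) (D i.+1).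
Proof. by case: Hch => _ + _ _; apply. Qed.

Lemma chain_nested i j : (i <= j)%N -> (j < n)%N -> D j `<=` D i.
Proof.
elim: j => [|j IH]; first by rewrite leqn0 => /eqP ->.
rewrite leq_eqVlt => /predU1P[-> //|ij] jn.
exact: fsubset_trans (step_sub (chain_stepP jn)) (IH ij (ltnW jn)).
Qed.

Lemma chain_orth i j g : (i < j)%N -> (j < n)%N -> g \in D j -> ip g (th (D i)) = 0.
Proof.
move=> ij jn gD; apply: (step_orth (chain_stepP (leq_ltn_trans ij jn))).
exact: fsubsetP (chain_nested ij jn) g gD.
Qed.

Lemma chain_th_in i : (i < n)%N -> th (D i) \in D i.
Proof. by move=> /chain_parabolic; apply: highest_in. Qed.

Lemma chain_th_Delta i : (i < n)%N -> th (D i) \in Delta.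
Proof. by move=> /chain_parabolic; apply: highest_in_Delta. Qed.

Lemma chain_th_long i : (i < n)%N ->
  forall b, b \in Delta -> ip b b <= ip (th (D i)) (th (D i)).
Proof.
move=> ltin; apply: (highest_long HD HP (chain_parabolic ltin)).
by case: Hch => _ _ _; apply.
Qed.

Lemma chain_th_orth i j : (i < n)%N -> (j < n)%N -> i != j ->
  ip (th (D i)) (th (D j)) = 0.
Proof.
move=> ltin jn; rewrite neq_ltn => /orP[ij|ji].
  by rewrite ipC; apply: chain_orth ij jn (chain_th_in jn).
by apply: chain_orth ji ltin (chain_th_in ltin).
Qed.

Lemma chain_sumE v :
  ip (chain_sum ip Pi ch) v = \sum_(i < n) ip (coroot ip (th (D i))) v.
Proof. by rewrite /chain_sum ip_suml (big_nth fset0) big_mkord. Qed.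

Lemma chain_sum_lattice : coroot_lattice ip Delta (chain_sum ip Pi ch).
Proof.
rewrite /chain_sum; apply: lattice_sum => C /(nthP fset0)[i ltin <-].
exact: chain_th_Delta.
Qed.

Lemma chain_sum_th i : (i < n)%N -> ip (chain_sum ip Pi ch) (th (D i)) = 2.
Proof.
move=> ltin; rewrite chain_sumE (bigD1 (Ordinal ltin)) //= big1 ?addr0 => [|j ji].
  by rewrite ipC coroot_self // (root_neq0 HD) // chain_th_Delta.
have ij : i != j by rewrite eq_sym.
by rewrite ip_corootl (chain_th_orth ltin (ltn_ord j) ij) mulr0 mul0r.
Qed.

(** A simple root belongs to the members of the chain up to some index m. *)
Lemma chain_last_index a : a \in Pi ->
  exists m, [/\ (m < n)%N, a \in D m & forall j, (m < j < n)%N -> a \notin D j].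
Proof.
move=> aPi.
have ex : exists m, (m < n)%N && (a \in D m).
  by exists 0%N; rewrite chain_size chain0 (simple_root HP).
have ub m : (m < n)%N && (a \in D m) -> (m <= n)%N by case/andP => /ltnW.
case: (ex_maxnP ex ub) => m /andP[mn aDm] mmax; exists m; split=> // j /andP[mj jn].
by apply/negP => aDj; have := mmax j; rewrite jn aDj leqNgt mj => /(_ isT).
Qed.

Lemma chain_sum_last m a : m.+1 = n -> a \in D m ->
  ip (chain_sum ip Pi ch) a = ip (coroot ip (th (D m))) a.
Proof.
move=> mE aDm; have mn : (m < n)%N by rewrite -mE.
rewrite chain_sumE (bigD1 (Ordinal mn)) //= big1 ?addr0 // => j jm.
have jm' : (j < m)%N.
  by have := ltn_ord j; have : (j : nat) != m := jm; lia.
by rewrite ip_corootl (chain_orth jm' mn aDm) mulr0 mul0r.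
Qed.

(** A simple root leaving the chain after the member m pairs at most with the
    highest roots of indices m and m + 1, and these pairings then cancel. *)
Lemma chain_sum_inner m a : (m.+1 < n)%N -> a \in Pi -> a \in D m -> a \notin D m.+1 ->
  ip (chain_sum ip Pi ch) a = 0.
Proof.
move=> m1n aPi aDm aDm1; have mn := ltnW m1n.
have HC := chain_parabolic mn; have HC' := chain_parabolic m1n.
have S := chain_stepP m1n.
have at_ge0 := highest_simple_ge0 HD HP HC aDm aPi.
have below j : (j < m)%N -> ip (coroot ip (th (D j))) a = 0.
  by move=> jm; rewrite ip_corootl (chain_orth jm mn aDm) mulr0 mul0r.
have [a0|a0] := eqVneq (ip a (th (D m))) 0.
  have aorth := step_split S aDm aDm1 a0.
  rewrite chain_sumE big1 // => j _; have [jm|mj] := ltnP j m; first exact: below.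
  rewrite ip_corootl; move: mj; rewrite leq_eqVlt => /predU1P[<-|mj].
    by rewrite a0 mulr0 mul0r.
  rewrite aorth ?mulr0 ?mul0r //.
  by apply: (fsubsetP (chain_nested mj (ltn_ord j))); apply: chain_th_in.
have at0 : 0 < ip a (th (D m)) by rewrite lt_def a0.
have at'0 := step_all_attached HD HP HC S aDm aPi at0.
have aD := simple_root HP aPi.
have tt' : ip (th (D m)) (th (D m.+1)) = 0 by rewrite chain_th_orth // ltn_eqF.
rewrite chain_sumE (bigD1 (Ordinal mn)) //= (bigD1 (Ordinal m1n)) /=; last first.
  by rewrite -(inj_eq val_inj) /= gtn_eqF.
rewrite big1 ?addr0 => [|j /andP[jm jm1]]; last first.
  rewrite -!(inj_eq val_inj) /= in jm jm1.
  have [ltjm|mj] := ltnP j m; first exact: below.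
  have mj' : (m.+1 < j)%N by rewrite ltn_neqAle eq_sym jm1 ltn_neqAle eq_sym jm.
  case: Hch => _ _ cond2 _.
  have := cond2 m j a; rewrite mj' ltn_ord.
  move=> /(_ isT aPi at0 _ (chain_th_in (ltn_ord j))).
  by rewrite ip_corootl => ->; rewrite mulr0 mul0r.
rewrite ipC [X in _ + X]ipC.
have -> : ip a (coroot ip (th (D m))) = 1.
  apply: le_anti; rewrite (coroot_ge1 HD) ?chain_th_Delta // andbT.
  apply: (coroot_le1 HD); rewrite ?chain_th_Delta ?chain_th_long //.
  by apply: contraTneq at'0 => ->; rewrite tt' ltxx.
have -> : ip a (coroot ip (th (D m.+1))) = -1; last by rewrite subrr.
apply: le_anti; rewrite (coroot_leN1 HD) ?chain_th_Delta //=.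
rewrite lerNl -ipNl.
apply: (coroot_le1 HD); rewrite ?chain_th_Delta ?(root_opp HD) //.
  by apply: chain_th_long => //; apply: (root_opp HD).
apply: contraNneq aDm1 => E; rewrite -[a]opprK E.
by apply: (root_opp (irr_parabolic_root_system HD HP HC')); apply: chain_th_in.
Qed.

Lemma chain_last : last Delta ch = D n.-1.
Proof. by rewrite -nth_last; apply: set_nth_default; rewrite ltn_predL chain_size. Qed.

Theorem chain_sum_Xplus : Xplus ip Delta Pi (chain_sum ip Pi ch).
Proof.
have th2 : ip (chain_sum ip Pi ch) (highest_root Delta Pi) = 2.
  by rewrite -(Delta_highest HP) -chain0 chain_sum_th // chain_size.
split; last first.
  by apply/eqP => E; move: th2; rewrite E ip0l; lra.
split; [exact: chain_sum_lattice| |by rewrite th2].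
move=> a aPi; have [m [mn aDm aout]] := chain_last_index aPi.
move: (mn); rewrite leq_eqVlt => /predU1P[mE|m1n].
  rewrite (chain_sum_last mE aDm) ipC.
  have t0 := root_neq0 HD (chain_th_Delta mn).
  rewrite leNgt coroot_lt0 // -leNgt.
  exact: (highest_simple_ge0 HD HP (chain_parabolic mn)).
by rewrite (chain_sum_inner m1n) // aout // ltnSn.
Qed.

Theorem chain_sum_neq0 a : a \in Pi ->
  ip (chain_sum ip Pi ch) a != 0 <->
  a \in nonorthogonal_simple_roots ip Pi (last Delta ch).
Proof.
move=> aPi; rewrite chain_last /nonorthogonal_simple_roots !inE /= aPi andbT.
have [m [mn aDm aout]] := chain_last_index aPi.
move: (mn); rewrite leq_eqVlt => /predU1P[mE|m1n].
  rewrite (chain_sum_last mE aDm) ipC coroot_eq0 ?(root_neq0 HD) ?chain_th_Delta //.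
  by rewrite -/n -mE /= aDm.
rewrite (chain_sum_inner m1n) // ?aout ?ltnSn // eqxx.
by rewrite (negPf (aout n.-1 _)) //; lia.
Qed.

End OneChain.

Section Converse.
Variable tau : V.
Hypothesis tauX : X ip Delta Pi tau.

(** The good chains on which tau behaves like the sum of the coroots of the
    highest roots: it takes the value 2 on each of these. *)
Definition tau_chain ch :=
  good_chain ch /\ forall C, C \in ch -> ip tau (th C) = 2.

Lemma tau_chain1 : tau != 0 -> tau_chain [:: Delta].
Proof.
move=> tau0; have [tauL _ _] := tauX; have HDp := Delta_parabolic HI HP.
split.
  split=> //=.
  - by split=> // -[|i].
  - move=> i j b /andP[ij]; rewrite ltnS leqn0 => /eqP j0.
    by rewrite j0 in ij.
  - move=> [|i] // _; exists (th Delta); first exact: (highest_in HD HP HDp).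
    split=> [|b bD]; first exact: (highest_in HD HP HDp).
    rewrite (Delta_highest HP).
    exact: (highest_longest HD HP (highest_rootP HD HP HI)).
move=> C; rewrite inE => /eqP ->.
have tau2 := tau_le2 HD HI HP tauX.
have [||||b [bD tb _]] := next_orth_root (ts := [::]) HD tauL tau2; rewrite ?big_nil //.
  exact/eqP.
apply: le_anti; rewrite tau2 ?(highest_in HD HP HDp) //= -tb.
apply: (highest_ge (irr_parabolic_highest HD HP HDp)) => // a.
by rewrite (Delta_simple HP); apply: (tau_ge0 tauX).
Qed.

(** While tau differs from the sum of the coroots, the chain can be extended by
    the component of a root on which tau is 2 and which is orthogonal to the
    highest roots so far. *)
Lemma tau_chain_extend ch : tau_chain ch -> tau <> chain_sum ip Pi ch ->
  exists2 C', tau_chain (rcons ch C') & (#|` C'| < #|` last Delta ch|)%N.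
Proof.
move=> [Hch ch2] ne; have [tauL _ _] := tauX; have tau2 := tau_le2 HD HI HP tauX.
have n0 := chain_size Hch.
set n := size ch in n0 *; pose D i := nth fset0 ch i.
have D2 i : (i < n)%N -> ip tau (th (D i)) = 2 by move=> ltin; apply/ch2/mem_nth.
have [||||b [bD tb borth]] := next_orth_root (ts := map th ch) HD tauL tau2.
- by move=> _ /mapP[C /(nthP fset0)[i ltin <-] ->]; apply: chain_th_Delta.
- apply/(pairwiseP 0) => i j; rewrite !inE size_map => ltin jn ij.
  rewrite !(nth_map fset0) //; apply/eqP.
  by apply: (chain_th_orth Hch) => //; rewrite ltn_eqF.
- by move=> _ /mapP[C Cch ->]; apply: ch2.
- by rewrite big_map.
have bth i : (i < n)%N -> ip b (th (D i)) = 0.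
  by move=> ltin; apply: borth; apply: map_f; apply: mem_nth.
have bin i : (i < n)%N -> b \in D i.
  elim: i => [|i IH] ltin; first by rewrite /D (chain0 Hch).
  have ltin' := ltnW ltin.
  apply: (tau_step_in HD HI HP tauX (chain_parabolic Hch ltin') (chain_stepP Hch ltin)).
  - exact: D2.
  - exact: IH.
  - exact: bth.
  - exact: tb.
have ln : (n.-1 < n)%N by rewrite ltn_predL.
have HC := chain_parabolic Hch ln; rewrite -/(D n.-1) in HC.
have bE : b \in [fset x in D n.-1 | ip x (th (D n.-1)) == 0].
  by rewrite !inE /= bin // bth // eqxx.
have [C' S bC'] := exists_component ip bE.
have HC' := step_parabolic HD HP HC S.
have tC' : ip tau (th C') = 2.
  apply: le_anti; rewrite tau2 ?(highest_in_Delta HD HP HC') //= -tb.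
  apply: (highest_ge (irr_parabolic_highest HD HP HC')) => // a /fsetIP[_].
  exact: (tau_ge0 tauX).
have C'sub i : (i < n)%N -> C' `<=` D i.
  move=> ltin; apply: fsubset_trans (step_sub S) _.
  by apply: (chain_nested Hch) => //; lia.
have C'orth i g : (i < n)%N -> g \in C' -> ip g (th (D i)) = 0.
  move=> ltin gC'; have : (i == n.-1) || (i < n.-1)%N by lia.
  case/orP => [/eqP ->|ilt]; first exact: (step_orth S).
  exact: (chain_orth Hch ilt ln (fsubsetP (step_sub S) g gC')).
exists C'; last first.
  rewrite (chain_last Hch) -/(D n.-1); apply: fproper_ltn_card.
  rewrite fproperEneq (step_sub S) andbT; apply/eqP => E.
  by have := step_notin HD HP HC S; rewrite E (highest_in HD HP HC).
split; last first.
  by move=> C; rewrite mem_rcons inE => /predU1P[->|/ch2].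
have nthE i : (i < n)%N -> nth fset0 (rcons ch C') i = D i.
  by move=> ltin; rewrite nth_rcons ltin.
have nthn : nth fset0 (rcons ch C') n = C' by rewrite nth_rcons ltnn eqxx.
have cases i : (i < n.+1)%N -> (i < n)%N \/ i = n by lia.
case: (Hch) => _ _ cond2 cond3.
split; rewrite size_rcons -/n.
- split=> //; first by rewrite nthE //; apply: (chain0 Hch).
  move=> i /cases[ltin|->]; first by rewrite nthE //; apply: (chain_parabolic Hch).
  by rewrite nthn.
- move=> i; rewrite ltnS => ltin; rewrite nthE //.
  have : (i.+1 < n)%N \/ i = n.-1 /\ i.+1 = n by lia.
  case=> [i1n|[iE i1E]]; first by rewrite nthE //; apply: (chain_stepP Hch).
  by rewrite i1E nthn iE.
- (* For the new member, c would be negative on the orthogonal highest roots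
     of D i.+1 and C', whereas tau is 2 on both and 0 on c. *)
  move=> i j c /andP[ij /cases[jn|jE]] cPi ct g.
    have ltin : (i < n)%N by lia.
    rewrite (nthE i ltin) in ct; rewrite (nthE j jn) => gD.
    by apply: (cond2 i j c _ cPi ct g gD); rewrite ij jn.
  rewrite jE in ij *; rewrite nthn => gC'.
  have i1n : (i.+1 < n)%N by lia.
  have ltin : (i < n)%N by lia.
  rewrite nthE // in ct.
  have Hi := chain_parabolic Hch ltin; have Hi1 := chain_parabolic Hch i1n.
  rewrite -/(D _) in Hi Hi1.
  have cD1 : c \notin D i.+1.
    apply/negP => h; have := chain_orth Hch (ltnSn i) i1n h.
    by rewrite -/(D i) => c0; rewrite c0 ltxx in ct.
  have tc : ip tau c = 0.
    by apply: (tau_outer HD HI HP tauX Hi1) => //; apply: D2.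
  have cD := simple_root HP cPi.
  have cC' : c \notin C' by apply: contra cD1; apply: (fsubsetP (C'sub _ i1n)).
  apply: contrapT => /eqP cg.
  have c1 := outer_highest_lt0 HD HP Hi1 cPi cD1 (fsubsetP (C'sub _ i1n) g gC') cg.
  have c2 := outer_highest_lt0 HD HP HC' cPi cC' gC' cg.
  have t1D := highest_in_Delta HD HP Hi1; have t2D := highest_in_Delta HD HP HC'.
  have := coroot_leN1 HD t1D cD c1; have := coroot_leN1 HD t2D cD c2.
  have t12 : ip (th (D i.+1)) (th C') = 0.
    by rewrite ipC; apply: C'orth => //; apply: (highest_in HD HP HC').
  have := tau_orth_bound2 HD HI HP tauX t1D t2D t12 (D2 _ i1n) tC' cD.
  by rewrite tc; lra.
- move=> i /cases[ltin|->]; first by rewrite nthE //; apply: cond3.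
  rewrite nthn; apply: (tau_step_long HD HI HP tauX HC S (D2 _ ln) tC').
  exact: (chain_th_long Hch ln).
Qed.

Theorem exists_good_chain : tau != 0 ->
  exists2 ch, good_chain ch & tau = chain_sum ip Pi ch.
Proof.
move=> tau0.
suff main n ch : (#|` last Delta ch| <= n)%N -> tau_chain ch ->
    exists2 ch, good_chain ch & tau = chain_sum ip Pi ch.
  exact: (main _ _ (leqnn _) (tau_chain1 tau0)).
elim: n ch => [|n IH] ch le_n Hch;
  have [E|ne] := pselect (tau = chain_sum ip Pi ch);
  try by exists ch => //; case: Hch.
  by have [C' _] := tau_chain_extend Hch ne; move: le_n; rewrite leqn0 => /eqP ->.
have [C' HC' lt_card] := tau_chain_extend Hch ne.
by apply: (IH (rcons ch C')) => //; rewrite last_rcons -ltnS (leq_trans lt_card).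
Qed.

End Converse.

End Chains.

Theorem proposition5p6 (R : realType) (V : vectType R) (ip : {dot V for idfun})
    (Delta Pi : {fset V}) :
  root_system ip Delta -> irreducible_roots ip Delta -> <<Delta>>%VS = fullv ->
  simple_roots Delta Pi ->
  (forall ch : seq {fset V}, good_chain ip Delta Pi ch ->
     Xplus ip Delta Pi (chain_sum ip Pi ch) /\
     (forall a : V, a \in Pi ->
        ip (chain_sum ip Pi ch) a != 0 <->
        a \in nonorthogonal_simple_roots ip Pi (last Delta ch)))
  /\
  (forall tau : V, Xplus ip Delta Pi tau ->
     exists2 ch : seq {fset V}, good_chain ip Delta Pi ch &
       tau = chain_sum ip Pi ch).
Proof.
move=> HD HI _ HP; split=> [ch Hch|tau [tauX tau0]].
  split; first exact: chain_sum_Xplus.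
  by move=> a aPi; apply: chain_sum_neq0.
exact: exists_good_chain.
Qed.
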